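(* Fix integers $0\le k<m$, $n\ge1$, $0\le l<r$. Let $\sigma:I^m\to J^r(\mathbb R^m,\mathbb R^n)$ be a smooth section such that $\sigma=0$ on an open neighborhood of $\partial I^m$ and $\sigma^{(l)}=0$ on all of $I^m$. Then for every $\varepsilon>0$ there exist an isotopy $F_t:I^m\to I^m$ and a holonomic section $\hat\sigma:I^m\to J^r(\mathbb R^m,\mathbb R^n)$ such that: $\mathrm{dist}_{C^0}(\hat\sigma,\sigma)<\varepsilon$ on an open neighborhood of $F_1(I^k)$; $\|\hat\sigma^{(l)}\|_{C^0}<\varepsilon$ on all of $I^m$; $\mathrm{dist}_{C^0}(F_t,\mathrm{id})<\varepsilon$; and $F_t=\mathrm{id}_{I^m}$ and $\hat\sigma=0$ on an open neighborhood of $\partial I^m$.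
   Context: $I=[-1,1]$ and $I^k\subset I^m$ is $I^k\times\{0\}^{m-k}$. $J^r(\mathbb R^m,\mathbb R^n)$ is the space of $r$-jets of maps $\mathbb R^m\to\mathbb R^n$, identified with $\mathbb R^m\times(\mathcal P_r)^n$ via Taylor polynomials of degree $\le r$; it is a vector bundle over $\mathbb R^m$ with the linear structure coming from $\mathbb R^n$, and $0$ denotes the zero section ($r$-jet of the zero map). $\sigma^{(l)}$ denotes the $l$-jet component (truncation of the Taylor polynomial to degree $\le l$). A section is holonomic if it equals $j^r(h)$ for a smooth $h:I^m\to\mathbb R^n$. *)

(* Defs.v *)
From mathcomp Require Import all_boot all_order all_algebra.
From mathcomp Require Import all_classical all_reals all_analysis.
Set Implicit Arguments. Unset Strict Implicit. Unset Printing Implicit Defensive.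
Import Order.TTheory GRing.Theory Num.Theory.
Import numFieldNormedType.Exports.
Local Open Scope classical_set_scope.
Local Open Scope ring_scope.

Section Defs.
Variable R : realType.

Fixpoint iderive {V W : normedModType R} (vs : seq V) (f : V -> W) : V -> W :=
  match vs with
  | [::] => f
  | v :: vs' => fun x => derive (iderive vs' f) x v
  end.

Definition smooth {V W : normedModType R} (f : V -> W) : Prop :=
  forall vs : seq V,
    continuous (iderive vs f) /\ (forall (v x : V), derivable (iderive vs f) x v).

Definition cube (m : nat) : set 'rV[R]_m := [set x | forall i, `|x ord0 i| <= 1].
Definition cube_boundary (m : nat) : set 'rV[R]_m :=
  [set x | cube x /\ exists i, `|x ord0 i| = 1].
Definition subcube (m k : nat) : set 'rV[R]_m :=
  [set x | cube x /\ forall i : 'I_m, (k <= i)%N -> x ord0 i = 0].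

Definition mdeg (m : nat) (a : 'I_m -> nat) : nat := (\sum_(i < m) a i)%N.
Definition mfact (m : nat) (a : 'I_m -> nat) : nat := (\prod_(i < m) (a i)`!)%N.

Definition pder (m : nat) (a : 'I_m -> nat) (f : 'rV[R]_m -> R) : 'rV[R]_m -> R :=
  iderive (flatten [seq nseq (a i) (delta_mx 0 i : 'rV[R]_m) | i <- enum 'I_m]) f.

(* A section of J^r(R^m,R^n) over R^m, J^r = R^m x (P_r)^n: at the point x, the
   jet is the n-tuple of Taylor polynomials  sum_{|a|<=r} s x a j * X^a ;
   only the coefficients with mdeg a <= r are meaningful. *)
Definition jet_section (m n : nat) := 'rV[R]_m -> ('I_m -> nat) -> 'I_n -> R.

Definition smooth_section (m n r : nat) (s : jet_section m n) : Prop :=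
  forall a j, (mdeg a <= r)%N -> smooth (fun x => s x a j).

Definition holonomic_on (m n r : nat) (A : set 'rV[R]_m) (s : jet_section m n) : Prop :=
  exists h : 'rV[R]_m -> 'rV[R]_n, smooth h /\
    forall x, A x -> forall a j, (mdeg a <= r)%N ->
      s x a j = pder a (fun y => h y ord0 j) x / (mfact a)%:R.

Definition isotopy (m : nat) (F : R * 'rV[R]_m -> 'rV[R]_m) : Prop :=
  smooth F /\ (forall x, F (0, x) = x) /\
  forall t, 0 <= t <= 1 ->
    (forall x, cube x -> cube (F (t, x))) /\
    exists G : 'rV[R]_m -> 'rV[R]_m, smooth G /\
      (forall y, cube y -> cube (G y)) /\
      (forall x, cube x -> G (F (t, x)) = x) /\
      (forall y, cube y -> F (t, G y) = y).

End Defs.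

(* Main.v *)
Require Import Defs.
From mathcomp Require Import all_boot all_order all_algebra.
From mathcomp Require Import all_classical all_reals all_analysis.
From mathcomp Require Import ring lra.
Set Implicit Arguments. Unset Strict Implicit. Unset Printing Implicit Defensive.
Import Order.TTheory GRing.Theory Num.Theory.
Import numFieldNormedType.Exports.
Local Open Scope classical_set_scope.
Local Open Scope ring_scope.

(** Let [i0] be a coordinate that vanishes on the subcube; the wiggled subcube is contained in a
    graph [x_i0 = phi x] with [phi] small and independent of [x_i0].

    Orders are treated one at a time. If all orders below [q] are already approximated near the
    graph, it remains to correct the derivatives of order [q] by functions whose derivatives of
    order [< q] are small on the whole cube. Every symbol of order [q] is a combination of powers
    [lambda ^ q] of linear forms, so one has to realize [c * lambda ^ q / q!] near a slightly
    wiggled graph. Let the graph oscillate with amplitude [1 / N] and period [rho / N] along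
    [lambda]. Near such a graph there is a function [z] with [lambda - z = O(1 / N)] and derivatives
    [D^j z = O(rho N^(j - 1))]: a staircase whose jumps happen along the steep parts of the graph.
    Then [c * (lambda - z) ^ q / q!] has the right derivatives of order [q] near the graph up to
    [O(rho + 1 / N)], and, after a bounded extension at scale [1 / N], its derivatives of order
    [< q] are [O(1 / N)] everywhere. The next wiggles stay within the neighbourhood where the
    previous approximations hold, and the isotopy pushes the subcube vertically onto the last
    graph. *)

(** * Calculus of smooth functions *)

(** Amplitude [1 / N] against period [rho / N] means slopes of order [1 / rho]: nothing is small
    about the graph function [phi] except its values. This steepness is what the construction lives
    on, and the obstacle for the isotopy. Keeping [phi] constant along the vertical direction
    removes the obstacle: multiplied by a cutoff, [phi] has a vertical Lipschitz constant governed
    by its sup norm alone, and no other derivative enters the invertibility of a vertical shift.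

    The constants are chosen in the order [rho], then [N]. Near the graph the error is a multiple of
    [rho + 1 / N] whose factor depends on neither, so [rho] can be made small against it. The bound
    on the whole cube may blow up as [rho] shrinks, but it is divided by [N], which comes last.

    The recursion over orders starts from the zero function at order [l]; this is where the
    vanishing of the [l]-jet enters, and why orders up to [l] stay small on the whole cube while
    higher ones are controlled only near the graph. *)

Section SmoothCalculus.
Context {R : realType}.
Implicit Types V W : normedModType R.

Lemma is_derive_derivable V W (f : V -> W) a v df :
  is_derive a v f df -> derivable f a v.
Proof. by case. Qed.

Lemma is_derive_val V W (f : V -> W) a v df : is_derive a v f df -> 'D_v f a = df.
Proof. by case. Qed.

Lemma iderive_cat V W (vs ws : seq V) (f : V -> W) :
  iderive (vs ++ ws) f = iderive vs (iderive ws f).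
Proof. by elim: vs => //= v vs ->. Qed.

Lemma iderive_rcons V W (vs : seq V) v (f : V -> W) :
  iderive (rcons vs v) f = iderive vs (fun x => 'D_v f x).
Proof. by rewrite -cats1 iderive_cat. Qed.

Lemma smooth_iderive V W (vs : seq V) (f : V -> W) :
  smooth f -> smooth (iderive vs f).
Proof. by move=> sf ws; rewrite -iderive_cat; exact: sf. Qed.

Lemma smooth_derive V W v (f : V -> W) : smooth f -> smooth (fun x => 'D_v f x).
Proof. by move=> sf; exact: (smooth_iderive [:: v] sf). Qed.

Lemma smooth_continuous V W (f : V -> W) : smooth f -> continuous f.
Proof. by move=> /(_ [::])[]. Qed.

Lemma smooth_derivable V W (f : V -> W) x v : smooth f -> derivable f x v.
Proof. by move=> /(_ [::])[_]; exact. Qed.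

(** Smoothness is the largest class of continuous, directionally derivable functions stable under
    every ['D_v], so naming one such class that contains [f] is enough. Closure properties below are
    obtained this way. *)
Lemma smooth_coind V W (P : (V -> W) -> Prop) :
  (forall f, P f -> continuous f) ->
  (forall f, P f -> forall v x, derivable f x v) ->
  (forall f, P f -> forall v, P (fun x => 'D_v f x)) ->
  forall f, P f -> smooth f.
Proof.
move=> Pc Pd Pst f Pf vs; have {Pf} Pi : P (iderive vs f).
  by elim: vs => //= v vs IH; exact: Pst.
by split; [exact: Pc | exact: Pd].
Qed.

Lemma smooth_cst V W (c : W) : smooth (fun _ : V => c).
Proof.
apply: (@smooth_coind _ _ (fun f : V -> W => exists c, f = fun=> c)); last by exists c.
- by move=> f [k ->] x; exact: cvg_cst.
- by move=> f [k ->] v x; exact: derivable_cst.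
- move=> f [k ->] v; exists 0; apply/funext => x.
  exact: derive_cst.
Qed.

Lemma derive_linear V W (f : V -> W) (v x : V) :
  (forall h : R, forall a b, f (h *: a + b) = h *: f a + f b) ->
  is_derive x v f (f v).
Proof.
move=> lf; have E : {near 0^', (fun h : R => f v) =1
   (fun h : R => h^-1 *: ((f \o shift x) (h *: v) - f x))}.
  near=> h; rewrite /= lf addrK scalerA mulVf ?scale1r//.
  by near: h; exact: nbhs_dnbhs_neq.
have C : (fun h : R => h^-1 *: ((f \o shift x) (h *: v) - f x)) @ 0^' --> f v.
  by apply: (cvg_trans (near_eq_cvg E)); exact: cvg_cst.
by split; [apply/cvg_ex; exists (f v)|exact: cvg_lim].
Unshelve. all: by end_near. Qed.

Lemma smooth_linear V W (f : V -> W) : continuous f ->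
  (forall h : R, forall a b, f (h *: a + b) = h *: f a + f b) -> smooth f.
Proof.
move=> cf lf [|v vs]; first by split => // v x; exact: (is_derive_derivable (derive_linear v x lf)).
(* The last vector of the list is the innermost derivative, and it already turns [f] into a
   constant. *)
have -> : iderive (v :: vs) f = iderive (belast v vs) (fun=> f (last v vs)).
  rewrite lastI iderive_rcons; congr iderive; apply/funext => x.
  exact: (is_derive_val (derive_linear (last v vs) x lf)).
exact: smooth_cst.
Qed.

(** A function [d 0] of one real variable packaged with the sequence of its derivatives, so that
    formulas and bounds can speak of every order at once. *)
Definition jets (d : nat -> R -> R) := forall n (x : R), is_derive x 1 (d n) (d n.+1 x).

Lemma derivable_continuous1 (f : R -> R) x : derivable f x 1 -> {for x, continuous f}.
Proof. by move=> df; apply/differentiable_continuous/derivable1_diffP. Qed.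

Lemma derive_line V W (f : V -> W) x v :
  'D_v f x = 'D_1 (fun h : R => f (h *: v + x)) (0 : R).
Proof.
rewrite /derive; set g1 := fun h => h^-1 *: _; set g2 := fun h => h^-1 *: _.
suff -> : g1 = g2 by [].
by rewrite funeqE /g1 /g2 => h /=; rewrite addr0 scale0r add0r [_%:A]mulr1.
Qed.

(* Only the outer function, of one real variable, has to be differentiable: directional
   derivability of [f] suffices. *)
Lemma is_derive_comp1 V (s : R -> R) (f : V -> R) x v (a b : R) :
  is_derive (f x) 1 s a -> is_derive x v f b ->
  is_derive x v (fun y => s (f y)) (a * b).
Proof.
move=> [ds es] [df ef].
pose g := fun h : R => f (h *: v + x).
have g0 : g 0 = f x by rewrite /g scale0r add0r.
have d1 : derivable g (0 : R) 1 := (derivable1P f x v).1 df.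
have d2 : derivable s (g 0) 1 by move: ds; rewrite -g0; exact.
have d3 : derivable (s \o g) (0 : R) 1.
  have e1 : differentiable g (0 : R) := (derivable1_diffP _ _).1 d1.
  have e2 : differentiable s (g 0) := (derivable1_diffP _ _).1 d2.
  by apply/derivable1_diffP; exact: (differentiable_comp e1 e2).
split; first exact: ((derivable1P (fun y => s (f y)) _ _).2 d3).
rewrite derive_line -[LHS]derive1E (derive1_comp d1 d2) !derive1E g0 es -ef.
by rewrite (derive_line f).
Qed.

(** The derivative of a product is a sum of products and that of an inverse contains products of
    inverses: none of these shapes is stable under derivatives alone, but their common closure is,
    and [smooth_coind] applies to it. The index [n] in [generated_comp] lets the chain rule pass
    from [d n] to [d n.+1]. *)
Inductive generated {V} : (V -> R) -> Prop :=
| generated_smooth f : smooth f -> generated f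
| generated_add f g : generated f -> generated g -> generated (fun x => f x + g x)
| generated_mul f g : generated f -> generated g -> generated (fun x => f x * g x)
| generated_inv f : (forall x, f x != 0) -> generated f -> generated (fun x => (f x)^-1)
| generated_comp d n f : jets d -> generated f -> generated (fun x => d n (f x)).

Lemma generated_continuous V (f : V -> R) : generated f -> continuous f.
Proof.
elim=> {f} [f sf|f g _ cf _ cg|f g _ cf _ cg|f f0 _ cf|d n f jd _ cf] x.
- exact: smooth_continuous.
- exact: cvgD (cf x) (cg x).
- exact: cvgM (cf x) (cg x).
- exact: cvgV (f0 x) (cf x).
- apply: continuous_comp; first exact: cf.
  apply: derivable_continuous1; exact: (is_derive_derivable (jd n (f x))).
Qed.

Lemma generated_derive V (f : V -> R) : generated f ->
  forall v, exists2 g, generated g & forall x, is_derive x v f (g x).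
Proof.
elim=> {f} [f sf|f g gf IHf gg IHg|f g gf IHf gg IHg|f f0 gf IHf|d n f jd gf IHf] v.
- exists (fun x => 'D_v f x); first by apply: generated_smooth; exact: smooth_derive.
  by move=> x; apply/derivableP; exact: smooth_derivable.
- have [f' ? Hf] := IHf v; have [g' ? Hg] := IHg v.
  exists (fun x => f' x + g' x); first exact: generated_add.
  by move=> x; exact: is_deriveD.
- have [f' ? Hf] := IHf v; have [g' ? Hg] := IHg v.
  exists (fun x => f x * g' x + g x * f' x).
    by apply: generated_add; exact: generated_mul.
  by move=> x; exact: is_deriveM.
- have [f' ? Hf] := IHf v.
  exists (fun x => (-1) * ((f x)^-1 * ((f x)^-1 * f' x))).
    do 3 ?[apply: generated_mul => //]; do ?exact: generated_inv.
    by apply: generated_smooth; exact: smooth_cst.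
  move=> x; have [df ef] := Hf x; split; first exact: derivableV.
  rewrite deriveV// ef /GRing.scale/= expr2 invfM; ring.
- have [f' ? Hf] := IHf v.
  exists (fun x => d n.+1 (f x) * f' x); first by apply: generated_mul => //; exact: generated_comp.
  by move=> x; exact: is_derive_comp1.
Qed.

Lemma generated_is_smooth V (f : V -> R) : generated f -> smooth f.
Proof.
apply: smooth_coind => {}f gf.
- exact: generated_continuous.
- by move=> v x; have [g _ Hg] := generated_derive gf v; exact: (is_derive_derivable (Hg x)).
- move=> v; have [g gg Hg] := generated_derive gf v.
  suff -> : (fun x => 'D_v f x) = g by [].
  by apply/funext => x; exact: (is_derive_val (Hg x)).
Qed.

Lemma smooth_add V (f g : V -> R) : smooth f -> smooth g -> smooth (fun x => f x + g x).
Proof. by move=> *; apply/generated_is_smooth/generated_add; exact: generated_smooth. Qed.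

Lemma smooth_mul V (f g : V -> R) : smooth f -> smooth g -> smooth (fun x => f x * g x).
Proof. by move=> *; apply/generated_is_smooth/generated_mul; exact: generated_smooth. Qed.

Lemma smooth_inv V (f : V -> R) : (forall x, f x != 0) -> smooth f -> smooth (fun x => (f x)^-1).
Proof. by move=> *; apply/generated_is_smooth/generated_inv => //; exact: generated_smooth. Qed.

Lemma smooth_comp1 V d n (f : V -> R) : jets d -> smooth f -> smooth (fun x => d n (f x)).
Proof. by move=> *; apply/generated_is_smooth/generated_comp => //; exact: generated_smooth. Qed.

Lemma smooth_scale V (k : R) (f : V -> R) : smooth f -> smooth (fun x => k * f x).
Proof. by apply: smooth_mul; exact: smooth_cst. Qed.

Lemma smooth_opp V (f : V -> R) : smooth f -> smooth (fun x => - f x).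
Proof.
move=> sf; have -> : (fun x => - f x) = (fun x => (-1) * f x) by apply/funext => x; rewrite mulN1r.
exact: smooth_scale.
Qed.

Lemma smooth_sub V (f g : V -> R) : smooth f -> smooth g -> smooth (fun x => f x - g x).
Proof. by move=> sf sg; exact: (smooth_add sf (smooth_opp sg)). Qed.

Lemma smooth_pow V (f : V -> R) q : smooth f -> smooth (fun x => f x ^+ q).
Proof.
move=> sf; elim: q => [|q IH]; first exact: smooth_cst.
have -> : (fun x => f x ^+ q.+1) = (fun x => f x * f x ^+ q) by apply/funext => x; rewrite exprS.
exact: smooth_mul.
Qed.

Lemma smooth_sum V (I : Type) (s : seq I) (P : pred I) (f : I -> V -> R) :
  (forall i, smooth (f i)) -> smooth (fun x => \sum_(i <- s | P i) f i x).
Proof.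
move=> sf; elim: s => [|i s IH].
  under eq_fun do rewrite big_nil; exact: smooth_cst.
under eq_fun do rewrite big_cons.
by case: (P i); [exact: (smooth_add (sf i) IH)|exact: IH].
Qed.

Lemma smooth_prod V (I : Type) (s : seq I) (f : I -> V -> R) :
  (forall i, smooth (f i)) -> smooth (fun x => \prod_(i <- s) f i x).
Proof.
move=> sf; elim: s => [|i s IH].
  under eq_fun do rewrite big_nil; exact: smooth_cst.
under eq_fun do rewrite big_cons.
exact: (smooth_mul (sf i) IH).
Qed.

Lemma smooth_coord m (i : 'I_m) : smooth (fun x : 'rV[R]_m => x ord0 i).
Proof.
apply: smooth_linear => [x|h a b]; last by rewrite !mxE.
exact: coord_continuous.
Qed.

(** The derivative along [v] of [f] composed with a linear [L] is the derivative of [f] along [L v],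
    again composed with [L]. *)
Lemma smooth_precomp V V' W (L : V -> V') (f : V' -> W) :
  continuous L -> (forall h : R, forall a b, L (h *: a + b) = h *: L a + L b) ->
  smooth f -> smooth (fun x => f (L x)).
Proof.
move=> cL lL sf.
apply: (@smooth_coind _ _ (fun g : V -> W => exists2 f, smooth f & g = fun x => f (L x)));
  last by exists f.
- move=> _ [g sg ->] x; apply: continuous_comp; [exact: cL|exact: smooth_continuous].
- move=> _ [g sg ->] v x; have /= := @smooth_derivable _ _ _ (L x) (L v) sg.
  rewrite /derivable; set a := fun _ => _; set b := fun _ => _.
  by have -> : a = b by apply/funext => h; rewrite /a /b /= lL.
- move=> _ [g sg ->] v; exists (fun y => 'D_(L v) g y); first exact: smooth_derive.
  apply/funext => x; rewrite /derive; set a := fun _ => _; set b := fun _ => _.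
  by have -> : a = b by apply/funext => h; rewrite /a /b /= lL.
Qed.

Lemma smooth_mx V m (f : V -> 'rV[R]_m) :
  (forall i, smooth (fun x => f x ord0 i)) -> smooth f.
Proof.
apply: (@smooth_coind _ _ (fun f : V -> 'rV[R]_m => forall i, smooth (fun x => f x ord0 i))) => {}f sf.
- move=> x; apply/cvgrPdist_le => /= e e0; near=> y.
  rewrite [leLHS]/Num.Def.normr/= mx_normrE (bigmax_le _ (ltW e0))//= => i _.
  rewrite !mxE (ord1 i.1); move: i; near: y; apply: filter_forall => i.
  have /(_ x)/cvgrPdist_le/(_ _ e0) : continuous (fun x => f x ord0 i.2).
    exact: smooth_continuous.
  exact.
- move=> v x; apply/derivable_mxP => i j; rewrite (ord1 i); exact: smooth_derivable.
- move=> v i.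
  have -> : (fun x => 'D_v f x ord0 i) = (fun x => 'D_v (fun t => f t ord0 i) x).
    apply/funext => x; rewrite derive_mx ?mxE//.
    by apply/derivable_mxP => a b; rewrite (ord1 a); exact: smooth_derivable.
  exact: smooth_derive.
Unshelve. all: by end_near. Qed.

Lemma near_eq_iderive V W (vs : seq V) (f g : V -> W) (x : V) :
  (\forall y \near x, f y = g y) -> \forall y \near x, iderive vs f y = iderive vs g y.
Proof.
elim: vs => //= v vs IH fg; have {}IH := IH fg.
have := near_join IH; apply: filterS => y Hy.
exact: near_eq_derive.
Qed.

Lemma iderive_add V (vs : seq V) (f g : V -> R) : smooth f -> smooth g ->
  iderive vs (fun x => f x + g x) = fun x => iderive vs f x + iderive vs g x.
Proof.
move=> sf sg; elim: vs => //= v vs ->; apply/funext => x.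
by rewrite deriveD//; apply: smooth_derivable; exact: smooth_iderive.
Qed.

Lemma iderive_scale V (vs : seq V) (k : R) (f : V -> R) : smooth f ->
  iderive vs (fun x => k * f x) = fun x => k * iderive vs f x.
Proof.
move=> sf; elim: vs => //= v vs ->; apply/funext => x.
by rewrite deriveZ//; apply: smooth_derivable; exact: smooth_iderive.
Qed.

Lemma iderive_cst V W (v : V) vs (c : W) : iderive (v :: vs) (fun=> c) = fun=> 0.
Proof.
elim: vs v => [|w vs IH] v; first by apply/funext => x /=; exact: derive_cst.
rewrite [LHS]/=; have /= -> := IH w.
by apply/funext => x; exact: derive_cst.
Qed.

End SmoothCalculus.

(** * The oscillating profile in one variable *)

Section OneVariable.
Context {R : realType}.

Lemma is_derive_scale (V : normedModType R) (f : V -> R) x v (k b : R) :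
  is_derive x v f b -> is_derive x v (fun y => k * f y) (k * b).
Proof. by move=> [df ef]; split; [exact: derivableZ|rewrite deriveZ// ef]. Qed.

Lemma is_derive_dir (f : R -> R) (x v a : R) : is_derive x (1 : R) f a -> is_derive x v f (a * v).
Proof. by move=> df; exact: (is_derive_comp1 (f := id) df (is_derive_id x v)). Qed.

Definition bounded_jets (d : nat -> R -> R) :=
  jets d /\ forall n, exists S, forall x, `|d n x| <= S.

Lemma jets_affine (d : nat -> R -> R) (a b : R) :
  jets d -> jets (fun n x => a ^+ n * d n (a * x + b)).
Proof.
move=> jd n x.
have da : is_derive x (1 : R) (fun y : R => a * y + b) a.
  apply: is_derive_eq; last by rewrite addr0 [LHS]mulr1.
have H := @is_derive_comp1 _ _ (d n) (fun y => a * y + b) x 1 _ _ (jd n _) da.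
apply: (is_derive_eq (is_derive_scale (a ^+ n) H)).
by rewrite /GRing.scale /= exprSr; ring.
Qed.

Lemma bounded_jets_affine (d : nat -> R -> R) (a b : R) :
  bounded_jets d -> bounded_jets (fun n x => a ^+ n * d n (a * x + b)).
Proof.
move=> [jd bd]; split=> [|n]; first exact: jets_affine.
have [S HS] := bd n; exists (`|a ^+ n| * S) => x.
by rewrite normrM ler_wpM2l.
Qed.

Lemma jets_unique (d d' : nat -> R -> R) (x : R) : jets d -> jets d' ->
  (\forall y \near x, d 0%N y = d' 0%N y) ->
  forall n, \forall y \near x, d n y = d' n y.
Proof.
move=> jd jd' e; elim=> // n /near_join; apply: filterS => y Hy.
by rewrite -(is_derive_val (jd n y)) -(is_derive_val (jd' n y)); exact: near_eq_derive.
Qed.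

Lemma smooth_jets (f : R -> R) : smooth f -> jets (fun n => iderive (nseq n (1 : R)) f).
Proof.
by move=> sf n x; apply/derivableP; apply: smooth_derivable; exact: smooth_iderive.
Qed.

(** Bounds on the whole line, for every derivative, make estimates of [s (f x)] insensitive to the
    size of [f x], which will grow with the scale [N]. *)
Definition bounded_smooth (s : R -> R) := exists2 d, bounded_jets d & d 0%N = s.

Lemma bounded_smooth_cst c : bounded_smooth (fun=> c).
Proof.
exists (fun n (_ : R) => if n is 0%N then c else 0) => //; split=> [n x|n].
  by case: n => [|n]; exact: is_derive_cst.
by eexists => x; exact: lexx.
Qed.

Lemma bounded_smooth_affine s a b : bounded_smooth s ->
  bounded_smooth (fun x => s (a * x + b)).
Proof.
move=> [d bd <-]; exists (fun n x => a ^+ n * d n (a * x + b)).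
  exact: bounded_jets_affine.
by apply/funext => x; rewrite expr0 mul1r.
Qed.

Lemma bounded_smooth_add s t : bounded_smooth s -> bounded_smooth t ->
  bounded_smooth (fun x => s x + t x).
Proof.
move=> [d [jd bd] <-] [d' [jd' bd'] <-]; exists (fun n x => d n x + d' n x) => //.
split=> [n x|n]; first exact: (is_deriveD (jd n x) (jd' n x)).
have [S HS] := bd n; have [S' HS'] := bd' n; exists (S + S') => x.
by rewrite (le_trans (ler_normD _ _))// lerD.
Qed.

Lemma bounded_smooth_scale k s : bounded_smooth s -> bounded_smooth (fun x => k * s x).
Proof.
move=> [d [jd bd] <-]; exists (fun n x => k * d n x) => //.
split=> [n x|n]; first exact: (is_derive_scale k (jd n x)).
by have [S HS] := bd n; exists (`|k| * S) => x; rewrite normrM ler_wpM2l.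
Qed.

Lemma smooth_bounded_comp (V : normedModType R) s (f : V -> R) :
  bounded_smooth s -> smooth f -> smooth (fun x => s (f x)).
Proof. by move=> [d [jd _] <-]; exact: smooth_comp1. Qed.

(** * A smooth step and a smooth sawtooth *)

Definition flat (k : nat) (x : R) : R := if 0 < x then x ^- k * expR (- x^-1) else 0.

Lemma flat_gt0 k x : 0 < x -> 0 < flat k x.
Proof. by move=> x0; rewrite /flat x0 mulr_gt0 ?expR_gt0// invr_gt0 exprn_gt0. Qed.

Lemma flat_ge0 k x : 0 <= flat k x.
Proof. by have [/flat_gt0-/(_ k)/ltW//|x0] := ltP 0 x; rewrite /flat ltNge x0. Qed.

(** One term of the exponential series at [x^-1], of order [k + 1], beats [x ^- k] with a factor [x]
    to spare. This gives the limit at [0]. *)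
Lemma flat_le k x : 0 < x -> flat k x <= k.+1`!%:R * x.
Proof.
move=> x0; rewrite /flat x0 expRN.
have := @expR_ge1Dxn R (x^-1) k; rewrite invr_ge0 ltW// => /(_ isT) H.
have f0 : 0 < (k.+1`!%:R : R) by rewrite ltr0n fact_gt0.
have xk : 0 < x ^+ k by rewrite exprn_gt0.
have e0 := expR_gt0 (x^-1).
have {}H : (x ^+ k.+1)^-1 <= k.+1`!%:R * expR x^-1.
  rewrite -exprVn mulrC -ler_pdivrMr//; lra.
rewrite ler_pdivrMr// -[x ^- k]div1r ler_pdivrMr//.
move: H; rewrite -[_^-1]div1r ler_pdivrMr ?exprn_gt0// exprS => /le_trans; apply.
by rewrite le_eqVlt; apply/orP; left; apply/eqP; ring.
Qed.

(** The exponent [k] makes the family closed under derivatives up to linear combinations. At [0] the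
    difference quotient of [flat k] is [flat k.+1], which tends to [0]. *)
Lemma is_derive_flat k x : is_derive x (1 : R) (flat k) (flat k.+2 x - k%:R * flat k.+1 x).
Proof.
have [x0|x0|->] := ltgtP x 0.
- have fz j y : y < 0 -> flat j y = 0 by move=> y0; rewrite /flat ltNge ltW.
  rewrite !fz// mulr0 subr0.
  apply: (@near_eq_is_derive _ _ _ (cst (0 : R))).
  have := lt_nbhsl x0; apply: filterS => y y0; by rewrite fz.
- have xn : x != 0 by rewrite gt_eqF.
  have dV : is_derive x (1 : R) (fun y : R => y^-1) (- x ^- 2).
    by apply: (is_derive_eq (is_deriveV xn (is_derive_id x (1 : R)))); rewrite [LHS]mulr1.
  have de : is_derive x (1 : R) (fun y : R => expR (- y^-1)) (expR (- x^-1) * x ^- 2).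
    have dn : is_derive x (1 : R) (fun y : R => - y^-1) (x ^- 2).
      by apply: (is_derive_eq (is_deriveN dV)); rewrite opprK.
    exact: (@is_derive_comp1 _ _ (@expR R) _ _ _ _ _ (is_derive_expR _) dn).
  apply: (near_eq_is_derive _ (is_derive_eq (is_deriveM (is_deriveX k dV) de) _)).
    by have := lt_nbhsr x0; apply: filterS => y y0; rewrite mulrfctE exprfctE /flat y0 -exprVn.
  rewrite /flat x0 /GRing.scale/= !exprfctE -!exprVn.
  by case: k => [|k]; rewrite ?mulr0 ?mul0r ?oppr0 /= ?exprS; ring.
- rewrite /flat !ltxx mulr0 subr0.
  suff C : (fun h : R => h^-1 *: ((flat k \o shift 0) (h *: 1) - flat k 0)) @ 0^' --> (0 : R).
    by split; [apply/cvg_ex; exists 0|exact: cvg_lim].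
  apply/cvgrPdist_le => /= e e0; near=> h.
  have h0 : h != 0 by near: h; exact: nbhs_dnbhs_neq.
  rewrite {2}/flat ltxx subr0 sub0r normrN addr0 [h *: 1]mulr1.
  have [hp|hn] := ltP 0 h; last by rewrite /flat ltNge hn scaler0 normr0 ltW.
  have -> : h^-1 *: flat k h = flat k.+1 h.
    by rewrite /flat hp /GRing.scale/= mulrA -exprVn -exprS exprVn.
  rewrite ger0_norm ?flat_ge0// (le_trans (flat_le _ hp))//.
  rewrite mulrC -ler_pdivlMr ?ltr0n ?fact_gt0//.
  rewrite -[h]gtr0_norm//; near: h; apply: dnbhs0_le.
  by rewrite divr_gt0// ltr0n fact_gt0.
Unshelve. all: by end_near. Qed.

Lemma smooth_flat k : smooth (flat k).
Proof.
pose P (f : R -> R) := exists s : seq (R * nat), f = fun x => \sum_(i <- s) i.1 * flat i.2 x.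
have dP (s : seq (R * nat)) (x v : R) : is_derive x v (fun x => \sum_(i <- s) i.1 * flat i.2 x)
    (\sum_(i <- flatten [seq [:: (i.1 * v, i.2.+2); (- (i.1 * v * i.2%:R), i.2.+1)] | i <- s])
       i.1 * flat i.2 x).
  elim: s => [|i s IH].
    by under eq_fun do rewrite big_nil; rewrite big_nil; exact: is_derive_cst.
  under eq_fun do rewrite big_cons.
  rewrite /= !big_cons /= addrA.
  apply: (is_derive_eq (is_deriveD (is_derive_scale i.1 (is_derive_dir v (is_derive_flat i.2 x))) IH)).
  by congr (_ + _); ring.
apply: (@smooth_coind _ _ _ P) => [f [s ->] x|f [s ->] v x|f [s ->] v|].
- by apply: derivable_continuous1; exact: (is_derive_derivable (dP s x 1)).
- exact: (is_derive_derivable (dP s x v)).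
- eexists; apply/funext => x; exact: (is_derive_val (dP s x v)).
- by exists [:: (1, k)]; apply/funext => x; rewrite big_seq1 mul1r.
Qed.

Lemma compact_interval_bound (f : R -> R) (a b : R) : continuous f ->
  exists S, forall x, a <= x <= b -> `|f x| <= S.
Proof.
move=> cf; have [ab|ba] := leP a b; last first.
  by exists 0 => x /andP[ax xb]; move: (le_lt_trans (le_trans ax xb) ba); rewrite ltxx.
have [|c _ Hc] := @EVT_max R (fun x => `|f x|) a b ab.
  apply: continuous_subspaceT => x; apply: (continuous_comp (cf x)).
  exact: norm_continuous.
by exists `|f c| => x xab; apply: Hc; rewrite in_itv.
Qed.

(** The quotient [flat 0 x / (flat 0 x + flat 0 (1 - x))] climbs from [0] to [1] on [[0, 1]]; its
    derivatives vanish outside, hence are bounded by compactness. The substitution [4 * x - 3/2]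
    squeezes the climb into [[3/8, 5/8]], a quarter of a unit, so that a period later has room for
    four phases. *)
Lemma exists_step : exists d : nat -> R -> R, [/\ bounded_jets d,
  forall x, x <= 3/8 -> d 0%N x = 0, forall x, 5/8 <= x -> d 0%N x = 1 &
  forall x, 0 <= d 0%N x <= 1].
Proof.
pose g (x : R) := flat 0 x + flat 0 (1 - x).
have g0 x : 0 < g x.
  have [x0|x0] := ltP 0 x; first by rewrite ltr_pwDl ?flat_gt0 ?flat_ge0.
  by rewrite ltr_pwDr ?flat_ge0 ?flat_gt0//; lra.
have s1 : smooth (fun x : R => flat 0 (1 - x)).
  have -> : (fun x : R => flat 0 (1 - x)) = (fun x => iderive (nseq 0 (1 : R)) (flat 0) (1 - x)) by [].
  apply: (smooth_comp1 (d := fun n => iderive (nseq n (1 : R)) (flat 0))).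
    by apply: smooth_jets; exact: smooth_flat.
  apply: smooth_sub; first exact: smooth_cst.
  by apply: smooth_linear => // x; exact: cvg_id.
pose f (x : R) := flat 0 x * (g x)^-1.
have sf : smooth f.
  apply: smooth_mul; first exact: smooth_flat.
  apply: smooth_inv => [x|]; first by rewrite gt_eqF.
  exact: (smooth_add (smooth_flat 0) s1).
have f_0 x : x <= 0 -> f x = 0 by move=> x0; rewrite /f /flat ltNge x0 mul0r.
have f_1 x : 1 <= x -> f x = 1.
  move=> x1; rewrite /f /g {3}/flat subr_gt0 ltNge x1 addr0 mulfV// gt_eqF// flat_gt0//; lra.
have jf := smooth_jets sf.
have f_der x : x < 0 \/ 1 < x -> forall n, iderive (nseq n.+1 (1 : R)) f x = 0.
  move=> xx n.
  have : \forall y \near x, f y = f x.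
    case: xx => [x0|x1].
      by have := lt_nbhsl x0; apply: filterS => y y0; rewrite !f_0// ltW.
    by have := lt_nbhsr x1; apply: filterS => y y0; rewrite !f_1// ltW.
  move=> /(near_eq_iderive (nseq n.+1 (1 : R))) /nbhs_singleton ->.
  by rewrite iderive_cst.
have bf : bounded_jets (fun n => iderive (nseq n (1 : R)) f).
  split=> // -[|n].
    exists 1 => x; have f0 : 0 <= f x by rewrite mulr_ge0 ?flat_ge0// invr_ge0 ltW.
    rewrite ger0_norm// /= /f ler_pdivrMr// mul1r lerDl; exact: flat_ge0.
  have [S HS] := @compact_interval_bound (iderive (nseq n.+1 (1 : R)) f) 0 1
     (smooth_continuous (smooth_iderive _ sf)).
  exists (Num.max 0 S) => x; rewrite le_max.
  have [x0|x0] := ltP x 0; first by rewrite f_der ?normr0 ?lexx//; left.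
  have [x1|x1] := ltP 1 x; first by rewrite f_der ?normr0 ?lexx//; right.
  by rewrite HS ?orbT// x0.
exists (fun n x => 4 ^+ n * iderive (nseq n (1 : R)) f (4 * x + (- (3/2)))); split.
- exact: (bounded_jets_affine 4 (- (3/2)) bf).
- by move=> x x3; rewrite /= expr0 mul1r f_0//; lra.
- by move=> x x3; rewrite /= expr0 mul1r f_1//; lra.
- move=> x; rewrite /= expr0 mul1r; set y := 4 * x + _.
  have fl := flat_ge0 0 (1 - y).
  apply/andP; split; first by rewrite mulr_ge0 ?flat_ge0// invr_ge0 ltW.
  by rewrite [f y]/(flat 0 y / g y) ler_pdivrMr// mul1r lerDl.
Qed.

(** Subtract from [u] the smooth staircase equal to [k] plus the step at [u - k] on [[k, k + 1]].
    What is left has period [1], so it is bounded with all its derivatives. *)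
Lemma exists_sawtooth : exists w : nat -> R -> R, bounded_jets w /\
  (forall (k : int) u, `|u - k%:~R| <= 3/8 -> w 0%N u = u - k%:~R) /\
  (forall (k : int) u, k%:~R <= u <= k%:~R + 1 -> k%:~R <= u - w 0%N u <= k%:~R + 1).
Proof.
have [d [[jd bd] d0 d1 d01]] := exists_step.
pose lin (n : nat) (z : R) : R := if n is n'.+1 then (n' == 0%N)%:R else z.
have jlin : jets lin.
  move=> [|n] x; first exact: is_derive_id.
  exact: is_derive_cst.
pose w n (x : R) := lin n (x - (Num.floor x)%:~R) - d n (x - (Num.floor x)%:~R).
(* Smooth model of [w] across the integer [k]: to the left of [k] the floor is [k - 1], but there
   the step has already reached [1] and makes up for it. *)
pose G (k : int) n (x : R) := 1 ^+ n * (lin n (1 * x + - k%:~R) - d n (1 * x + - k%:~R)).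
have jG k : jets (G k).
  apply: (@jets_affine (fun n x => lin n x - d n x) 1 (- k%:~R)) => n x.
  exact: (is_deriveB (jlin n x) (jd n x)).
have dn0 n x : x < 3/8 \/ 5/8 < x -> d n.+1 x = 0.
  move=> xx.
  pose c m (_ : R) : R := if m is 0%N then d 0%N x else 0.
  have jc : jets c by move=> [|m] y; exact: is_derive_cst.
  have H : \forall y \near x, d 0%N y = c 0%N y.
    case: xx => [x0|x1].
      by have := lt_nbhsl x0; apply: filterS => y y0; rewrite /c !d0// ltW.
    by have := lt_nbhsr x1; apply: filterS => y y0; rewrite /c !d1// ltW.
  exact: (nbhs_singleton (jets_unique jd jc H n.+1)).
have wG (k : int) n x : k%:~R - 3/8 < x < k%:~R + 1 -> w n x = G k n x.
  move=> /andP[kx xk]; rewrite /w /G expr1n !mul1r.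
  have [kx'|xk'] := leP k%:~R x.
    rewrite (_ : Num.floor x = k)//; apply: floor_def.
    by rewrite kx' /= intrD.
  rewrite (_ : Num.floor x = k - 1); last first.
    by apply: floor_def; rewrite subrK xk' andbT intrB; lra.
  rewrite intrB; case: n => [|n].
    by rewrite /= d1 ?d0; lra.
  by rewrite !dn0 /=; [ |left; lra|right; lra].
have wk (k : int) u : `|u - k%:~R| <= 3/8 -> w 0%N u = u - k%:~R.
  rewrite ler_distl => /andP[h1 h2]; rewrite /w.
  have [kx'|xk'] := leP k%:~R u.
    rewrite (_ : Num.floor u = k); first by rewrite d0 /=; lra.
    by apply: floor_def; rewrite kx' /= intrD; lra.
  rewrite (_ : Num.floor u = k - 1); last first.
    by apply: floor_def; rewrite subrK xk' andbT intrB; lra.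
  by rewrite d1 /= intrB; lra.
exists w; split; last first.
  split=> // k u /andP[ku uk]; have [->|uk'] := eqVneq u (k%:~R + 1).
    have -> : w 0%N (k%:~R + 1) = 0.
      by rewrite (wk (k + 1)) intrD subrr// normr0; lra.
    by rewrite subr0; apply/andP; split; lra.
  rewrite /w (_ : Num.floor u = k); last by apply: floor_def; rewrite ku intrD lt_neqAle uk'.
  by have /andP[? ?] := d01 (u - k%:~R); rewrite /=; apply/andP; split; lra.
split=> [n x|n].
  have := floor_itv x; set k := Num.floor x; rewrite intrD => /andP[kx xk].
  have H : k%:~R - 3/8 < x < k%:~R + 1 by apply/andP; split; lra.
  rewrite (wG k)//; apply: near_eq_is_derive (jG k n x).
  move/andP : H => [/lt_nbhsr Ha /lt_nbhsl Hb].
  near=> y; rewrite (wG k)//; apply/andP; split; near: y; [exact: Ha|exact: Hb].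
have [S HS] := bd n; exists (1 + S) => x.
rewrite (le_trans (ler_normB _ _))// lerD// /lin.
case: n HS => [|[|n]] _; last 2 first; rewrite ?normr1 ?normr0//.
have := floor_itv x; rewrite intrD ler_norml => /andP[kx xk].
by apply/andP; split; lra.
Unshelve. all: by end_near. Qed.


(* [t - D u] small describes a thin neighbourhood of the oscillating graph [t = D u]; there the
   sawtooth [w u - th t * B u] differs from [u] by a constant, up to a multiple of [th t]. With
   [A u := u - w u], the staircase [A u + th t * B u] equals [A u] at the bottom of the graph and
   [A (u + 1/2)] at the top: each is locally constant where it is used. *)
Lemma exists_profile : exists w th B D tau : R -> R,
  [/\ bounded_smooth w, bounded_smooth th, bounded_smooth B, bounded_smooth D & bounded_smooth tau] /\
  (forall u, 0 <= D u <= 1) /\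
  forall u0 t0, `|t0 - D u0| < 1/8 -> exists C0 kappa delta,
    [/\ 0 < delta, `|kappa| <= 1, `|u0 - C0| <= 1, `|t0| <= 2 &
    forall u t, `|u - u0| < delta -> `|t - t0| < delta ->
      w u - th t * B u = u - C0 - kappa * th t /\ tau t = t].
Proof.
have [ws [bw [wk wA]]] := exists_sawtooth.
have [ths [bth th0 th1 _]] := exists_step.
pose w := ws 0%N; pose th := ths 0%N.
have sw : bounded_smooth w by exists ws.
have sth : bounded_smooth th by exists ths.
(* In terms of the staircase [A u = u - w u], one has [B u = A (u + 1/2) - A u] and
   [D u = A (u + 1/4) - A (u - 1/4)]. The bounded function [tau] is the identity on [[-1/4, 5/4]],
   which contains all heights within [1/8] of the graph with a margin of [1/8]. *)
pose B u := 1/2 + (w u + (-1) * w (1 * u + 1/2)).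
pose D u := 1/2 + ((-1) * w (1 * u + 1/4) + w (1 * u + (- (1/4)))).
pose tau t := 1/2 + 2 * w (1/2 * t + (- (1/4))).
exists w, th, B, D, tau; split.
  split=> //.
  - apply: bounded_smooth_add; first exact: bounded_smooth_cst.
    apply: bounded_smooth_add => //; apply: bounded_smooth_scale; exact: bounded_smooth_affine.
  - apply: bounded_smooth_add; first exact: bounded_smooth_cst.
    apply: bounded_smooth_add; last exact: bounded_smooth_affine.
    apply: bounded_smooth_scale; exact: bounded_smooth_affine.
  - apply: bounded_smooth_add; first exact: bounded_smooth_cst.
    apply: bounded_smooth_scale; exact: bounded_smooth_affine.
have DE u : D u = 1/2 - w (u + 1/4) + w (u + - (1/4)) by rewrite /D (mul1r u); ring.
have BE u : B u = 1/2 + w u - w (u + 1/2) by rewrite /B (mul1r u); ring.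
have tE t : tau t = 1/2 + 2 * w (1/2 * t + - (1/4)) by [].
have {}th0 x : x <= 3/8 -> th x = 0 := th0 x.
have {}th1 x : 5/8 <= x -> th x = 1 := th1 x.
have {}wk (k : int) u : `|u - k%:~R| <= 3/8 -> w u = u - k%:~R := wk k u.
have {}wA (k : int) u : k%:~R <= u <= k%:~R + 1 -> k%:~R <= u - w u <= k%:~R + 1 := wA k u.
clear sw sth bw bth; clearbody w th B D tau.
have wk0 (k : int) v : - (3/8) <= v - k%:~R <= 3/8 -> w v = v - k%:~R.
  by move=> H; apply: wk; rewrite ler_norml.
have wk1 (k : int) v : 5/8 <= v - k%:~R <= 11/8 -> w v = v - k%:~R - 1.
  move=> /andP[h1 h2]; rewrite (wk0 (k + 1)) intrD; first by lra.
  by apply/andP; split; lra.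
have wA' (k : int) v : 0 <= v - k%:~R <= 1 -> 0 <= v - k%:~R - w v <= 1.
  move=> /andP[h1 h2]; have /wA/andP[h3 h4] : k%:~R <= v <= k%:~R + 1 by apply/andP; split; lra.
  by apply/andP; split; lra.
have fl (u : R) : exists k : int, 0 <= u - k%:~R < 1.
  exists (Num.floor u); have := floor_itv u; rewrite intrD => /andP[? ?].
  by apply/andP; split; lra.
(* The phases of [D] over a period: bottom around the integer, rise on [[1/8, 3/8]], top on
   [[3/8, 5/8]], descent on [[5/8, 7/8]], bottom again. Each shift of [A] jumps in exactly one of
   them. *)
have Dbot (k : int) u : - (1/8) <= u - k%:~R <= 1/8 -> D u = 0.
  move=> /andP[h1 h2]; rewrite DE !(wk0 k); [lra| |]; by apply/andP; split; lra.
have Dbot1 (k : int) u : 7/8 <= u - k%:~R <= 1 -> D u = 0.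
  by move=> /andP[h1 h2]; apply: (Dbot (k + 1)); rewrite intrD; apply/andP; split; lra.
have Dtop (k : int) u : 3/8 <= u - k%:~R <= 5/8 -> D u = 1.
  move=> /andP[h1 h2]; rewrite DE (wk0 k (u + - _)) ?(wk1 k (u + 1/4)); first lra.
  - by apply/andP; split; lra.
  - by apply/andP; split; lra.
have Dup (k : int) u : 1/8 <= u - k%:~R <= 3/8 -> 0 <= D u <= 1.
  move=> /andP[h1 h2]; rewrite DE (wk0 k (u + - _)); last by apply/andP; split; lra.
  have /wA'/andP[h3 h4] : 0 <= (u + 1/4) - k%:~R <= 1 by apply/andP; split; lra.
  by apply/andP; split; lra.
have Ddown (k : int) u : 5/8 <= u - k%:~R <= 7/8 -> 0 <= D u <= 1.
  move=> /andP[h1 h2]; rewrite DE (wk1 k (u + 1/4)); last by apply/andP; split; lra.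
  have /wA'/andP[h3 h4] : 0 <= (u + - (1/4)) - k%:~R <= 1 by apply/andP; split; lra.
  by apply/andP; split; lra.
have D01 u : 0 <= D u <= 1.
  have [k /andP[h1 h2]] := fl u.
  have [c1|c1] := leP (u - k%:~R) (1/8).
    by rewrite (Dbot k) ?lexx ?ler01//; apply/andP; split; lra.
  have [c2|c2] := leP (u - k%:~R) (3/8); first by apply: (Dup k); apply/andP; split; lra.
  have [c3|c3] := leP (u - k%:~R) (5/8).
    by rewrite (Dtop k) ?lexx ?ler01//; apply/andP; split; lra.
  have [c4|c4] := leP (u - k%:~R) (7/8); first by apply: (Ddown k); apply/andP; split; lra.
  by rewrite (Dbot1 k) ?lexx ?ler01//; apply/andP; split; lra.
split=> // u0 t0; have /andP[D0 D1] := D01 u0.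
rewrite ltr_distl => /andP[t0l t0u].
have t2 : `|t0| <= 2 by rewrite ler_norml; apply/andP; split; lra.
have tauE (t : R) : `|t - t0| < 1/8 -> tau t = t.
  rewrite ltr_distl => /andP[h1 h2]; rewrite tE (wk0 0); first by rewrite mulr0z; lra.
  by rewrite mulr0z; apply/andP; split; lra.
have [k /andP[h1 h2]] := fl u0.
have n1 (a : R) : -1 <= u0 - a <= 1 -> `|u0 - a| <= 1 by move=> H; rewrite ler_norml.
have p8 : 0 < 1/8 :> R by lra.
have n11 : `|1 : R| <= 1 by rewrite normr1.
have n00 : `|0 : R| <= 1 by rewrite normr0.
(* The quantity [C0 + kappa * th t] is [k] at the bottom, climbs to [k + 1] with [th t] along the
   rising flank only, and remains [k + 1] over the top, the descent and the next bottom. It thus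
   follows [u] up to a bounded error although [t] returns to its initial height. *)
have [c1|c1] := leP (u0 - k%:~R) (1/8).
  have Du : D u0 = 0 by apply: (Dbot k); apply/andP; split; lra.
  exists k%:~R, 0, (1/8); split=> //; [by apply: n1; apply/andP; split; lra|].
  move=> u t; rewrite !ltr_distl => /andP[h3 h4] /andP[h5 h6]; split; last first.
    by apply: tauE; rewrite ltr_distl h5.
  rewrite th0 ?mul0r; last by lra.
  by rewrite (wk0 k) ?subr0 ?mul0r ?subr0//; apply/andP; split; lra.
have [c2|c2] := ltP (u0 - k%:~R) (3/8).
  exists k%:~R, 1, (Num.min (u0 - k%:~R - 1/8) (3/8 - (u0 - k%:~R))); split=> //.
  - by rewrite lt_min; apply/andP; split; lra.
  - by apply: n1; apply/andP; split; lra.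
  move=> u t; rewrite !lt_min !ltr_distl => /andP[+ +] /andP[+ +].
  move=> /andP[h3 h4] /andP[h5 h6] /andP[h7 h8] /andP[h9 h10]; split; last first.
    by apply: tauE; rewrite ltr_distl; apply/andP; split; lra.
  rewrite BE (wk0 k u) ?(wk1 k (u + 1/2)); last 2 first.
  - by apply/andP; split; lra.
  - by apply/andP; split; lra.
  by ring.
have [c3|c3] := leP (u0 - k%:~R) (5/8).
  have Du : D u0 = 1 by apply: (Dtop k); apply/andP; split; lra.
  exists (k%:~R + 1), 0, (1/8); split=> //; [by apply: n1; apply/andP; split; lra|].
  move=> u t; rewrite !ltr_distl => /andP[h3 h4] /andP[h5 h6]; split; last first.
    by apply: tauE; rewrite ltr_distl h5.
  rewrite th1; last by lra.
  rewrite BE (wk1 k (u + 1/2)) ?mul0r; first by ring.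
  by apply/andP; split; lra.
have [c4|c4] := ltP (u0 - k%:~R) (7/8).
  exists (k%:~R + 1), 0, (Num.min (u0 - k%:~R - 5/8) (7/8 - (u0 - k%:~R))); split=> //.
  - by rewrite lt_min; apply/andP; split; lra.
  - by apply: n1; apply/andP; split; lra.
  move=> u t; rewrite !lt_min !ltr_distl => /andP[+ +] /andP[+ +].
  move=> /andP[h3 h4] /andP[h5 h6] /andP[h7 h8] /andP[h9 h10]; split; last first.
    by apply: tauE; rewrite ltr_distl; apply/andP; split; lra.
  rewrite BE (wk1 k u) ?(wk1 k (u + 1/2)); last 2 first.
  - by apply/andP; split; lra.
  - by apply/andP; split; lra.
  by ring.
have Du : D u0 = 0 by apply: (Dbot1 k); apply/andP; split; lra.
exists (k%:~R + 1), 0, (1/8); split=> //; [by apply: n1; apply/andP; split; lra|].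
move=> u t; rewrite !ltr_distl => /andP[h3 h4] /andP[h5 h6]; split; last first.
  by apply: tauE; rewrite ltr_distl h5.
rewrite th0 ?mul0r; last by lra.
rewrite (wk1 k); first by ring.
by apply/andP; split; lra.
Qed.

End OneVariable.

(** * Partial derivatives at a scale *)

Arguments smooth_derivable {R V W f} x v _.

Section PartialDerivatives.
Context {R : realType} {m : nat}.
Implicit Types (f g : 'rV[R]_m -> R) (p : 'rV[R]_m) (js : seq 'I_m) (C N : R).

Definition pd js f : 'rV[R]_m -> R := iderive [seq (delta_mx 0 i : 'rV[R]_m) | i <- js] f.

Lemma pd_rcons js i f : pd (rcons js i) f = pd js (pd [:: i] f).
Proof. by rewrite /pd map_rcons iderive_rcons. Qed.

Lemma smooth_pd js f : smooth f -> smooth (pd js f).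
Proof. exact: smooth_iderive. Qed.

Lemma pd_add js f g : smooth f -> smooth g ->
  pd js (fun x => f x + g x) = fun x => pd js f x + pd js g x.
Proof. exact: iderive_add. Qed.

Lemma pd_scale js k f : smooth f -> pd js (fun x => k * f x) = fun x => k * pd js f x.
Proof. exact: iderive_scale. Qed.

Lemma pd_sub js f g : smooth f -> smooth g ->
  pd js (fun x => f x - g x) = fun x => pd js f x - pd js g x.
Proof.
move=> sf sg; rewrite (pd_add js sf (smooth_opp sg)).
apply/funext => x; congr (_ + _).
have -> : (fun x => - g x) = (fun x => (-1) * g x) by apply/funext => y; rewrite mulN1r.
by rewrite (pd_scale js (-1) sg) mulN1r.
Qed.

Lemma near_pd js f g p : (\forall x \near p, f x = g x) -> pd js f p = pd js g p.
Proof. by move/(near_eq_iderive [seq delta_mx 0 i | i <- js])/nbhs_singleton. Qed.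

Lemma pd1_mul i f g : smooth f -> smooth g ->
  pd [:: i] (fun x => f x * g x) = fun x => f x * pd [:: i] g x + g x * pd [:: i] f x.
Proof.
move=> sf sg; apply/funext => x.
rewrite /pd/=.
have df := smooth_derivable x (delta_mx 0 i) sf.
have dg := smooth_derivable x (delta_mx 0 i) sg.
by rewrite (deriveM df dg).
Qed.

Lemma pd_cst i js (c : R) : pd (i :: js) (fun=> c) = fun=> 0.
Proof. exact: iderive_cst. Qed.

(* The scale at which [f] varies is [1 / N]: each derivative costs a factor [N]. *)
Definition scale_bound n C N p f :=
  forall js, (size js <= n)%N -> `|pd js f p| <= C * N ^+ size js.

(** Each derivative splits a product in two, whence [2 ^+ n]. Peeling off the innermost derivative
    turns a bound [C] into [C * N] for one order less. *)
Lemma scale_bound_mul n C C' N p f g : 0 <= N -> smooth f -> smooth g ->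
  scale_bound n C N p f -> scale_bound n C' N p g ->
  scale_bound n (2 ^+ n * C * C') N p (fun x => f x * g x).
Proof.
move=> N0; elim: n f g C C' => [|n IH] f g C C' sf sg bf bg js.
  rewrite leqn0 => /nilP ->; rewrite expr0 mulr1 mul1r normrM.
  by have := bf [::] isT; have := bg [::] isT; rewrite !mulr1 => ? ?; exact: ler_pM.
have bf' : scale_bound n C N p f by move=> ks kn; apply: bf; exact: ltnW.
have bg' : scale_bound n C' N p g by move=> ks kn; apply: bg; exact: ltnW.
have C0 : 0 <= C by have := bf [::] isT; rewrite mulr1; exact: le_trans.
have C0' : 0 <= C' by have := bg [::] isT; rewrite mulr1; exact: le_trans.
have dd D h i : scale_bound n.+1 D N p h -> scale_bound n (D * N) N p (pd [:: i] h).
  move=> bh ks kn; rewrite -pd_rcons; apply: (le_trans (bh _ _)); first by rewrite size_rcons.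
  by rewrite size_rcons exprS mulrA.
case/lastP: js => [_|js i].
  rewrite mulr1 normrM.
  apply: le_trans (_ : C * C' <= _).
    by have := bf [::] isT; have := bg [::] isT; rewrite !mulr1 => ? ?; exact: ler_pM.
  by rewrite -mulrA ler_peMl ?mulr_ge0// exprn_ege1// ler1n.
rewrite size_rcons ltnS => jn; rewrite pd_rcons (pd1_mul i sf sg).
rewrite (pd_add js (smooth_mul sf (smooth_pd [:: i] sg)) (smooth_mul sg (smooth_pd [:: i] sf))).
apply: (le_trans (ler_normD _ _)).
have H1 := IH f (pd [:: i] g) C (C' * N) sf (smooth_pd _ sg) bf' (dd _ _ i bg) js jn.
have H2 := IH g (pd [:: i] f) C' (C * N) sg (smooth_pd _ sf) bg' (dd _ _ i bf) js jn.
apply: (le_trans (lerD H1 H2)); rewrite !exprS le_eqVlt; apply/orP; left; apply/eqP; ring.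
Qed.

Lemma scale_bound_add n C C' N p f g : smooth f -> smooth g ->
  scale_bound n C N p f -> scale_bound n C' N p g ->
  scale_bound n (C + C') N p (fun x => f x + g x).
Proof.
move=> sf sg bf bg js jn; rewrite pd_add// mulrDl (le_trans (ler_normD _ _))// lerD//.
  exact: bf.
exact: bg.
Qed.

Lemma scale_bound_scale n C N p k f : smooth f ->
  scale_bound n C N p f -> scale_bound n (`|k| * C) N p (fun x => k * f x).
Proof. by move=> sf bf js jn; rewrite pd_scale// normrM -mulrA ler_wpM2l// bf. Qed.

Lemma scale_bound_sub n C C' N p f g : smooth f -> smooth g ->
  scale_bound n C N p f -> scale_bound n C' N p g ->
  scale_bound n (C + C') N p (fun x => f x - g x).
Proof.
move=> sf sg bf bg js jn; rewrite pd_sub// mulrDl (le_trans (ler_normB _ _))// lerD//.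
  exact: bf.
exact: bg.
Qed.

Lemma scale_bound_le n C C' N p f : 0 <= N -> C <= C' ->
  scale_bound n C N p f -> scale_bound n C' N p f.
Proof.
by move=> N0 CC bf js jn; rewrite (le_trans (bf _ jn))// ler_wpM2r// exprn_ge0.
Qed.

Lemma scale_bound_ge0 n C N p f : scale_bound n C N p f -> 0 <= C.
Proof. by move=> /(_ [::] isT); rewrite mulr1; exact: le_trans. Qed.

Lemma scale_bound_cst n N p (c : R) : 0 <= N -> scale_bound n `|c| N p (fun=> c).
Proof.
move=> N0 [|i js] jn; first by rewrite mulr1.
by rewrite pd_cst normr0 mulr_ge0// exprn_ge0.
Qed.

Lemma scale_bound_exp n C N p f q : 0 <= N -> smooth f -> scale_bound n C N p f ->
  scale_bound n ((2 ^+ n * C) ^+ q) N p (fun x => f x ^+ q).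
Proof.
move=> N0 sf bf; elim: q => [|q IH].
  by rewrite expr0 -[X in scale_bound _ X]normr1; exact: scale_bound_cst.
have -> : (fun x => f x ^+ q.+1) = (fun x => f x * f x ^+ q) by apply/funext => x; rewrite exprS.
rewrite exprS; exact: (scale_bound_mul N0 sf (smooth_pow q sf) bf IH).
Qed.

(** Only derivatives of [f] of positive order are constrained, because [s] is bounded with all its
    derivatives. The constant is uniform in [N], [p] and [f], so that [N] can be chosen after it. *)
Lemma scale_bound_comp s n C : bounded_smooth s -> exists K, forall N p f, 0 <= N -> smooth f ->
  (forall js, (0 < size js <= n)%N -> `|pd js f p| <= C * N ^+ size js) ->
  scale_bound n K N p (fun x => s (f x)).
Proof.
(* Strengthened to all derivatives [d j] of [s], since the chain rule brings in [d j.+1]. *)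
move=> [d [jd bd] <-]; suff: forall j, exists K, forall N p f, 0 <= N -> smooth f ->
  (forall js, (0 < size js <= n)%N -> `|pd js f p| <= C * N ^+ size js) ->
  scale_bound n K N p (fun x => d j (f x)) by apply.
elim: n => [|n IH] j.
  have [S HS] := bd j; exists S => N p f N0 sf bf js.
  by rewrite leqn0 => /nilP ->; rewrite mulr1; exact: HS.
have [S HS] := bd j; have [K HK] := IH j.+1.
exists (Num.max S (2 ^+ n * K * C)) => N p f N0 sf bf js.
case/lastP: js => [_|js i]; first by rewrite mulr1 le_max HS.
rewrite size_rcons ltnS => jn; rewrite pd_rcons.
have -> : pd [:: i] (fun x => d j (f x)) = fun x => d j.+1 (f x) * pd [:: i] f x.
  apply/funext => x; rewrite /pd /=.
  exact: (is_derive_val (is_derive_comp1 (jd j (f x)) (derivableP (smooth_derivable x (delta_mx 0 i) sf)))).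
have b1 : scale_bound n K N p (fun x => d j.+1 (f x)).
  by apply: HK => // ks /andP[k0 kn]; apply: bf; rewrite k0 ltnW.
have b2 : scale_bound n (C * N) N p (pd [:: i] f).
  move=> ks kn; rewrite -pd_rcons; apply: le_trans (bf _ _) _; first by rewrite size_rcons.
  by rewrite size_rcons exprS mulrA.
have sd : smooth (fun x => d j.+1 (f x)) := smooth_comp1 j.+1 jd sf.
apply: (le_trans (scale_bound_mul N0 sd (smooth_pd [:: i] sf) b1 b2 jn)).
have -> : 2 ^+ n * K * (C * N) * N ^+ size js = 2 ^+ n * K * C * N ^+ (size js).+1.
  by rewrite exprS; ring.
by rewrite ler_wpM2r ?exprn_ge0// le_max lexx orbT.
Qed.

(** Telescoping. The point is that the estimate is linear in the distance [b] of [f] and [g], with a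
    factor fixed by their common bound [A] and the orders alone. *)
Lemma scale_bound_exp_sub n A q : exists K, forall N p f g b, 0 <= N -> smooth f -> smooth g ->
  scale_bound n A N p f -> scale_bound n A N p g -> scale_bound n b N p (fun x => f x - g x) ->
  scale_bound n (K * b) N p (fun x => f x ^+ q - g x ^+ q).
Proof.
elim: q => [|q [K HK]].
  exists 0 => N p f g b N0 *; rewrite mul0r -[X in scale_bound _ X](@normr0 _ R).
  have -> : (fun x => f x ^+ 0 - g x ^+ 0) = (fun=> 0) by apply/funext => x; rewrite subrr.
  exact: scale_bound_cst.
exists (2 ^+ n * A * K + 2 ^+ n * (2 ^+ n * A) ^+ q) => N p f g b N0 sf sg bf bg bfg.
have -> : (fun x => f x ^+ q.+1 - g x ^+ q.+1) =
    (fun x => f x * (f x ^+ q - g x ^+ q) + (f x - g x) * g x ^+ q).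
  by apply/funext => x; rewrite !exprS; ring.
have sd : smooth (fun x => f x ^+ q - g x ^+ q) by apply: smooth_sub; exact: smooth_pow.
have b1 := scale_bound_mul N0 sf sd bf (HK _ _ _ _ _ N0 sf sg bf bg bfg).
have b2 := scale_bound_mul N0 (smooth_sub sf sg) (smooth_pow q sg) bfg (scale_bound_exp q N0 sg bg).
have := scale_bound_add (smooth_mul sf sd) (smooth_mul (smooth_sub sf sg) (smooth_pow q sg)) b1 b2.
by apply: scale_bound_le => //; rewrite le_eqVlt; apply/orP; left; apply/eqP; ring.
Qed.

(** At full order the power of [f] disappears and [q!] times a product of slopes is left: hence the
    normalization by [q!] in the corrections. *)
Lemma pd_affine_exp (f : 'rV[R]_m -> R) (a : 'I_m -> R) q js : smooth f ->
  (forall i, pd [:: i] f = fun=> a i) -> (size js <= q)%N ->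
  pd js (fun x => f x ^+ q) =
    fun x => (q ^_ (size js))%:R * \prod_(i <- js) a i * f x ^+ (q - size js).
Proof.
move=> sf fa; elim: js => [_|i js IH jq].
  by apply/funext => x; rewrite big_nil /= ffactn0 subn0 !mul1r.
have jq' : (size js < q)%N by [].
have -> : pd (i :: js) (fun x => f x ^+ q) = pd [:: i] (pd js (fun x => f x ^+ q)) by [].
rewrite (IH (ltnW jq')) (pd_scale [:: i] _ (smooth_pow (q - size js) sf)).
apply/funext => x; rewrite (_ : pd [:: i] _ x = (q - size js)%:R * f x ^+ (q - size js).-1 * a i).
  rewrite big_cons /= ffactnSr natrM -subn1 -subnDA addn1; ring.
have := is_derive_val (is_deriveX (q - size js) (derivableP (smooth_derivable x (delta_mx 0 i) sf))).
rewrite exprfctE => H; rewrite [LHS]H.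
by congr (_ * _); exact: (congr1 (fun h => h x) (fa i)).
Qed.

(** * The sup norm and the compact cube *)

Lemma rV_norm_le (M : R) (x : 'rV[R]_m) :
  0 <= M -> (forall i, `|x ord0 i| <= M) -> `|x| <= M.
Proof.
move=> M0 xM; rewrite [leLHS]/Num.Def.normr/= mx_normrE.
by apply: bigmax_le => // -[i j] _; rewrite (ord1 i).
Qed.

Lemma rV_coord_le_norm (x : 'rV[R]_m) i : `|x ord0 i| <= `|x|.
Proof.
rewrite [leRHS]/Num.Def.normr/= mx_normrE.
exact: (le_bigmax _ (fun k : 'I_1 * 'I_m => `|x k.1 k.2|) (ord0, i)).
Qed.

Lemma cubeE : @cube R m = [set x | `|x| <= 1].
Proof.
apply/seteqP; split=> x /= cx; first exact: rV_norm_le.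
by move=> i; apply: le_trans (rV_coord_le_norm x i) cx.
Qed.

Lemma cube_compact : compact (@cube R m).
Proof.
rewrite cubeE; apply: bounded_closed_compact.
  by exists 1; split; [exact: num_real|move=> M M1 x /= /le_trans; apply; exact: ltW].
apply: (@preimage_closed _ _ (fun x : 'rV[R]_m => `|x|) [set y | y <= 1]); last exact: closed_le.
by move=> x _; exact: norm_continuous.
Qed.

Lemma cube0 : cube (0 : 'rV[R]_m).
Proof. by move=> i; rewrite mxE normr0. Qed.

Lemma cube_pd_bound n f : smooth f -> exists C, forall p js, cube p -> (size js <= n)%N ->
  `|pd js f p| <= C.
Proof.
elim: n f => [|n IH] f sf.
  have cf : continuous (fun x => `|f x|).
    move=> x; apply: (@continuous_comp _ _ _ f (fun y : R => `|y|)).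
      exact: smooth_continuous.
    exact: norm_continuous.
  have [|||c _ Hc] := @EVT_max_rV R m (fun x => `|f x|) (@cube R m).
  - by exists 0; exact: cube0.
  - exact: cube_compact.
  - exact: continuous_subspaceT.
  exists `|f c| => p js cp; rewrite leqn0 => /nilP ->; apply: Hc; exact/mem_set.
have [C0 HC0] := IH f sf.
have /choice[C HC] : forall i, exists C, forall p js, cube p -> (size js <= n)%N ->
    `|pd js (pd [:: i] f) p| <= C by move=> i; apply: IH; exact: smooth_pd.
exists (C0 + \sum_i `|C i|) => p js cp.
case/lastP: js => [_|js i].
  by apply: (le_trans (HC0 p [::] cp isT)); rewrite lerDl sumr_ge0.
rewrite size_rcons ltnS => jn; rewrite pd_rcons (le_trans (HC i p js cp jn))//.
rewrite (bigD1 i)//= (le_trans (ler_norm _))// addrCA lerDl addr_ge0 ?sumr_ge0//.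
by apply: le_trans (HC0 p [::] cp isT).
Qed.

End PartialDerivatives.

(** * One wiggle *)

Section Wiggle.
Context {R : realType} {m : nat} (i0 : 'I_m).
Implicit Types (phi c : 'rV[R]_m -> R) (lam : 'I_m -> R) (p : 'rV[R]_m) (C N : R).

(** Such a function depends on the other coordinates only; it is kept on the full space so that no
    change of dimension intervenes. *)
Definition vertically_invariant phi := forall x (k : R), phi (x + k *: delta_mx 0 i0) = phi x.

Lemma smooth_linear_form lam : smooth (fun x : 'rV[R]_m => \sum_i lam i * x ord0 i).
Proof. by apply: smooth_sum => i; apply: smooth_scale; exact: smooth_coord. Qed.

Lemma pd_linear_form lam i :
  pd [:: i] (fun x : 'rV[R]_m => \sum_i lam i * x ord0 i) = fun=> lam i.
Proof.
apply/funext => x; rewrite /pd/=.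
rewrite (is_derive_val (derive_linear (delta_mx 0 i) x _)) => [|h a b].
  rewrite (bigD1 i)//= mxE !eqxx mulr1 big1 ?addr0// => j ji.
  by rewrite mxE eq_sym (negbTE ji) andbF mulr0.
rewrite /GRing.scale /= mulr_sumr -big_split /=.
by apply: eq_bigr => j _; rewrite !mxE; ring.
Qed.

Lemma linear_form_shift lam (x : 'rV[R]_m) (k : R) :
  \sum_i lam i * (x + k *: delta_mx 0 i0 : 'rV[R]_m) ord0 i = \sum_i lam i * x ord0 i + k * lam i0.
Proof.
have -> : k * lam i0 = \sum_i lam i * (k * (delta_mx 0 i0 : 'rV[R]_m) ord0 i).
  rewrite (bigD1 i0)//= mxE !eqxx mulr1 big1 ?addr0 1?mulrC// => j ji.
  by rewrite mxE (negbTE ji) andbF !mulr0.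
by rewrite -big_split /=; apply: eq_bigr => j _; rewrite !mxE mulrDr.
Qed.

Lemma invr_fact_le1 n : (n`!%:R : R)^-1 <= 1.
Proof. by rewrite invf_le1 ?ltr0n ?ler1n fact_gt0. Qed.

Lemma scale_bound_of_const n C N p c : 1 <= N ->
  (forall js, (size js <= n)%N -> `|pd js c p| <= C) -> scale_bound n C N p c.
Proof.
move=> N1 bc js jn; apply: (le_trans (bc js jn)).
have C0 : 0 <= C := le_trans (normr_ge0 _) (bc js jn).
by rewrite ler_peMr// exprn_ege1.
Qed.

(** An order [j < q] costs at most a factor [N ^ j] against the prefactor [N ^- q], which leaves at
    most [1 / N]. *)
Lemma wiggle_cube_estimate q (C KE : R) : (0 < q)%N -> exists K, forall N p (c E : 'rV[R]_m -> R),
  1 <= N -> smooth c -> smooth E ->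
  (forall js, (size js <= q)%N -> `|pd js c p| <= C) -> scale_bound q KE N p E ->
  forall js, (size js < q)%N ->
    `|pd js (fun x => c x * (N ^- q / q`!%:R * E x ^+ q)) p| <= K * N^-1.
Proof.
move=> q0; exists (2 ^+ q * C * (2 ^+ q * KE) ^+ q) => N p c E N1 sc sE bc bE js jq.
have N0 : 0 < N := lt_le_trans ltr01 N1.
have sEq := smooth_pow q sE.
have b := scale_bound_mul (ltW N0) sc sEq (scale_bound_of_const N1 bc) (scale_bound_exp q (ltW N0) sE bE).
have K0 := scale_bound_ge0 b.
set K := 2 ^+ q * C * _ in b K0 *; set k := N ^- q / _.
have -> : (fun x => c x * (k * E x ^+ q)) = (fun x => k * (c x * E x ^+ q)).
  by apply/funext => x; ring.
rewrite (pd_scale js k (smooth_mul sc sEq)) normrM.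
have k0 : 0 <= k by rewrite mulr_ge0 ?invr_ge0 ?exprn_ge0// ltW.
rewrite (ger0_norm k0).
apply: (@le_trans _ _ (N ^- q * (K * N ^+ size js))).
  apply: ler_pM => //; last exact: b (ltnW jq).
  by rewrite /k ler_piMr ?invr_fact_le1// invr_ge0 exprn_ge0// ltW.
rewrite mulrCA ler_wpM2l// mulrC -ler_pdivlMr ?invr_gt0 ?exprn_gt0// invrK.
rewrite -[leRHS]mulrC -ler_pdivrMr ?invr_gt0// invrK -exprSr.
exact: ler_weXn2l.
Qed.

(** Near [p], [E] is an affine function [L] with slopes [N * lam i] minus a perturbation of size
    [rho] at scale [1 / N]. Write [c * E ^ q] as [(c - c p) * E ^ q + c p * (E ^ q - L ^ q) + c p *
    L ^ q]: the last term gives the symbol exactly, the middle one costs [rho], the first one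
    [1 / N]. The factor [K] is fixed before [rho] and [N]. *)
Lemma wiggle_tube_estimate (th : R -> R) q lam (C : R) : bounded_smooth th ->
  exists2 K, 0 <= K & forall (rho N b kappa : R) p (c T E : 'rV[R]_m -> R),
  0 <= rho <= 1 -> 1 <= N -> `|kappa| <= 1 -> smooth c -> smooth T -> smooth E ->
  (forall js, (0 < size js <= q)%N -> `|pd js T p| <= C * N ^+ size js) ->
  (forall js, (size js <= q)%N -> `|pd js c p| <= C) ->
  `|N * (\sum_i lam i * p ord0 i) - b| <= C ->
  (\forall x \near p, E x = N * (\sum_i lam i * x ord0 i) - b - rho * kappa * th (T x)) ->
  forall js, size js = q ->
    `|pd js (fun x => c x * (N ^- q / q`!%:R * E x ^+ q)) p - c p * \prod_(i <- js) lam i|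
      <= K * (N^-1 + rho).
Proof.
move=> bth; have [Kth HKth] := @scale_bound_comp R m th q C bth.
pose A := C + \sum_i `|lam i| + `|Kth|.
have [K1 HK1] := @scale_bound_exp_sub R m q A q.
pose P := (2 ^+ q * A) ^+ q.
exists (`|2 ^+ q * C * P| + `|C * K1 * Kth|); first by rewrite addr_ge0.
move=> rho N b kappa p c T E /andP[rho0 rho1] N1 kappa1 sc sT sE bT bc Lp Enear js jq.
have N0 : 0 < N := lt_le_trans ltr01 N1.
have C0 : 0 <= C := le_trans (normr_ge0 _) Lp.
have NX n : 0 <= N ^+ n by rewrite exprn_ge0 ?(ltW N0).
have Ni : 0 <= N^-1 by rewrite invr_ge0 (ltW N0).
have bthT := HKth N p T (ltW N0) sT bT.
have Kth0 := scale_bound_ge0 bthT.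
have sthT := smooth_bounded_comp bth sT.
pose L (x : 'rV[R]_m) := N * (\sum_i lam i * x ord0 i) - b.
pose W x := rho * kappa * th (T x).
pose E' x := L x - W x.
have sl := smooth_linear_form lam.
have sNl : smooth (fun x : 'rV[R]_m => N * (\sum_i lam i * x ord0 i)) := smooth_scale N sl.
have sL : smooth L := smooth_sub sNl (smooth_cst b).
have sW : smooth W := smooth_scale (rho * kappa) sthT.
have sE' : smooth E' := smooth_sub sL sW.
have pdL i : pd [:: i] L = fun=> N * lam i.
  rewrite (pd_sub [:: i] sNl (smooth_cst b)) (pd_scale [:: i] N sl) pd_linear_form.
  by rewrite pd_cst; apply/funext => x; rewrite subr0.
have slam : forall i, `|lam i| <= \sum_i `|lam i|.
  by move=> i; rewrite (bigD1 i)//= lerDl sumr_ge0.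
have slam0 : 0 <= \sum_i `|lam i| by rewrite sumr_ge0.
have bL : scale_bound q (C + \sum_i `|lam i|) N p L.
  move=> ks; case/lastP: ks => [_|ks i].
    by rewrite mulr1; apply: (le_trans Lp); rewrite lerDl.
  rewrite size_rcons pd_rcons pdL => _; case: ks => [|j ks].
    rewrite /pd/= normrM (gtr0_norm N0) expr1 mulrC ler_wpM2r ?(ltW N0)//.
    by apply: (le_trans (slam i)); rewrite lerDr.
  by rewrite pd_cst normr0 mulr_ge0 ?exprn_ge0 ?addr_ge0// ltW.
have bW : scale_bound q (rho * Kth) N p W.
  apply: scale_bound_le (scale_bound_scale (rho * kappa) sthT bthT); first exact: ltW.
  rewrite normrM (ger0_norm rho0) -mulrA ler_wpM2l//.
  by rewrite -[leRHS]mul1r ler_wpM2r.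
have bW1 : scale_bound q Kth N p W.
  by apply: scale_bound_le bW; [exact: ltW|rewrite -[leRHS]mul1r ler_wpM2r].
have bE' : scale_bound q A N p E'.
  apply: scale_bound_le (scale_bound_sub sL sW bL bW1); first exact: ltW.
  by rewrite lerD2l ler_norm.
have bLA : scale_bound q A N p L.
  by apply: scale_bound_le bL; [exact: ltW|rewrite lerDl].
have bEL : scale_bound q (rho * Kth) N p (fun x => E' x - L x).
  have -> : (fun x => E' x - L x) = (fun x => (-1) * W x) by apply/funext => x; rewrite /E'; ring.
  by have := scale_bound_scale (-1) sW bW; rewrite normrN1 mul1r.
have bD := HK1 N p E' L _ (ltW N0) sE' sL bE' bLA bEL.
have bP := scale_bound_exp q (ltW N0) sE' bE'.
have sEq := smooth_pow q sE'.
have sLq := smooth_pow q sL.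
have sc' : smooth (fun x => c x - c p) := smooth_sub sc (smooth_cst (c p)).
(* The difference vanishes at [p] and the derivatives of [c] do not grow with [N], so a factor
   [1 / N] is gained at every positive order. *)
have bc' : scale_bound q (C / N) N p (fun x => c x - c p).
  move=> ks kq; rewrite (pd_sub ks sc (smooth_cst (c p))).
  case: ks kq => [|i ks] kq.
    by rewrite /pd/= subrr normr0 mulr1 divr_ge0// ltW.
  rewrite pd_cst subr0; apply: (le_trans (bc _ kq)).
  by rewrite /= exprS mulrA divfK ?gt_eqF// ler_peMr// exprn_ege1.
set k := N ^- q / _.
pose f1 x := (c x - c p) * E' x ^+ q.
pose f2 x := E' x ^+ q - L x ^+ q.
have s1 : smooth f1 := smooth_mul sc' sEq.
have s2 : smooth f2 := smooth_sub sEq sLq.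
pose f3 x := c p * f2 x.
have s3 : smooth f3 := smooth_scale (c p) s2.
pose f4 x := c p * L x ^+ q.
have s4 : smooth f4 := smooth_scale (c p) sLq.
have s13 : smooth (fun x => f1 x + f3 x) := smooth_add s1 s3.
have s134 : smooth (fun x => f1 x + f3 x + f4 x) := smooth_add s13 s4.
have -> : pd js (fun x => c x * (k * E x ^+ q)) p = pd js (fun x => k * (f1 x + f3 x + f4 x)) p.
  apply: near_pd; move: Enear; apply: filterS => x ->.
  by rewrite /f1 /f3 /f2 /f4 -/(L x) -/(W x) -/(E' x); ring.
rewrite (pd_scale js k s134) (pd_add js s13 s4) (pd_add js s1 s3).
rewrite (pd_scale js (c p) sLq) (pd_affine_exp sL pdL); last by rewrite jq.
have -> : \prod_(i <- js) (N * lam i) = N ^+ q * \prod_(i <- js) lam i.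
  by rewrite big_split/= big_const_seq count_predT jq iter_mulr_1.
have qf : (q`!%:R : R) != 0 by rewrite pnatr_eq0 -lt0n fact_gt0.
have Nq : N ^+ q != 0 by rewrite expf_neq0// gt_eqF.
have -> : k * (pd js f1 p + pd js f3 p + c p * ((q ^_ size js)%:R * (N ^+ q * \prod_(i <- js) lam i) *
    L p ^+ (q - size js))) - c p * \prod_(i <- js) lam i = k * (pd js f1 p + pd js f3 p).
  rewrite jq subnn expr0 mulr1 ffactnn mulrDr -addrA -[RHS]addr0; congr (_ + _).
  by rewrite /k; field; rewrite qf Nq.
have H1 : `|pd js f1 p| <= (`|2 ^+ q * C * P| / N) * N ^+ q.
  have := scale_bound_mul (ltW N0) sc' sEq bc' bP (eq_leq jq); rewrite -/P jq => /le_trans; apply.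
  rewrite ler_wpM2r ?NX//.
  have -> : 2 ^+ q * (C / N) * P = 2 ^+ q * C * P / N by ring.
  by rewrite ler_wpM2r// ler_norm.
have H3 : `|pd js f3 p| <= (`|C * K1 * Kth| * rho) * N ^+ q.
  rewrite (pd_scale js (c p) s2) normrM.
  have := bD js (eq_leq jq); rewrite jq => H.
  have cp := bc [::] isT.
  apply: (le_trans (ler_pM _ _ cp H)) => //.
  have -> : C * (K1 * (rho * Kth) * N ^+ q) = C * K1 * Kth * rho * N ^+ q by ring.
  by rewrite ler_wpM2r ?NX// ler_wpM2r ?ler_norm.
have k0 : 0 <= k by rewrite mulr_ge0 ?invr_ge0 ?exprn_ge0// ltW.
rewrite normrM (ger0_norm k0).
set X := `|2 ^+ q * C * P| in H1 *; set Y := `|C * K1 * Kth| in H3 *.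
have X0 : 0 <= X by rewrite /X normr_ge0.
have Y0 : 0 <= Y by rewrite /Y normr_ge0.
apply: (@le_trans _ _ (k * ((X / N + Y * rho) * N ^+ q))).
  by rewrite ler_wpM2l// (le_trans (ler_normD _ _))// mulrDl lerD.
have -> : k * ((X / N + Y * rho) * N ^+ q) = (q`!%:R)^-1 * (X / N + Y * rho).
  by rewrite /k; field; rewrite qf Nq gt_eqF.
apply: (@le_trans _ _ (1 * (X / N + Y * rho))).
  by rewrite ler_wpM2r ?invr_fact_le1// addr_ge0// mulr_ge0.
rewrite mul1r mulrDl !mulrDr -addrA lerD2l.
by rewrite addrA lerDr addr_ge0 ?mulr_ge0.
Qed.

Lemma wiggle_step phi c lam q (nu : R) : smooth phi -> smooth c -> (0 < q)%N -> 0 < nu ->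
  vertically_invariant phi -> exists (phi' e : 'rV[R]_m -> R) (eta : R),
  [/\ smooth phi', smooth e, 0 < eta, vertically_invariant phi' &
      forall x, `|phi' x - phi x| <= nu] /\
  (forall p js, cube p -> (size js < q)%N -> `|pd js (fun x => c x * e x) p| <= nu) /\
  (forall p js, cube p -> `|p ord0 i0 - phi' p| < eta -> size js = q ->
    `|pd js (fun x => c x * e x) p - c p * \prod_(i <- js) lam i| <= nu).
Proof.
move=> sphi sc q0 nu0 iphi.
have [w [th [B [D [tau [[bw bth bB bD btau] [D01 prof]]]]]]] := @exists_profile R.
pose l (x : 'rV[R]_m) := \sum_i lam i * x ord0 i.
pose t (x : 'rV[R]_m) := x ord0 i0 - phi x.
(* The form [lambda] may have a vertical component, so it cannot itself be the phase of a vertically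
   invariant graph. Its values on the old graph, carried along the verticals, can; the difference
   [lam i0 * t] is restored through [tau] in [E]. *)
pose mu x := l x - lam i0 * t x.
have sl : smooth l := smooth_linear_form lam.
have st : smooth t := smooth_sub (smooth_coord i0) sphi.
have smu : smooth mu := smooth_sub sl (smooth_scale (lam i0) st).
have [Ct HCt] := cube_pd_bound q st.
have [Cmu HCmu] := cube_pd_bound q smu.
have [Cc HCc] := cube_pd_bound q sc.
(* Will bound [rho * (U p - C0) + lam i0 * T p], given [rho <= 1] and the bounds [1] and [2]
   supplied by the profile. *)
pose M := 1 + 2 * `|lam i0|.
pose C := M + `|Ct| + `|Cc|.
have M0 : 0 <= M by rewrite addr_ge0// mulr_ge0.
have CtC : Ct <= C by rewrite /C (le_trans (ler_norm _))// -addrA addrCA lerDl addr_ge0.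
have CcC : Cc <= C by rewrite /C (le_trans (ler_norm _))// addrC lerDl addr_ge0.
have MC : M <= C by rewrite /C -addrA lerDl addr_ge0.
have [K K0 HK] := wiggle_tube_estimate q lam C bth.
pose rho := Num.min 1 (nu / (2 * (K + 1))).
have K1 : 0 < K + 1 by lra.
have rho0 : 0 < rho by rewrite lt_min ltr01/= divr_gt0// mulr_gt0.
have rho1 : rho <= 1 by rewrite ge_min lexx.
have Krho : K * rho <= nu / 2.
  apply: (@le_trans _ _ ((K + 1) * (nu / (2 * (K + 1))))).
    apply: ler_pM => //; [exact: ltW|by rewrite lerDl|by rewrite ge_min lexx orbT].
  by rewrite le_eqVlt; apply/orP; left; apply/eqP; field; rewrite gt_eqF.
have [Kw HKw] := @scale_bound_comp R m w q (`|Cmu / rho|) bw.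
have [KB HKB] := @scale_bound_comp R m B q (`|Cmu / rho|) bB.
have [Kth HKth] := @scale_bound_comp R m th q (`|Ct|) bth.
have [Ktau HKtau] := @scale_bound_comp R m tau q (`|Ct|) btau.
pose KE := `|rho| * (Kw + 2 ^+ q * Kth * KB) + `|lam i0| * Ktau.
have [K2 HK2] := wiggle_cube_estimate Cc KE q0.
(* One summand per requirement: [K2 / N <= nu] on the cube, [K / N <= nu / 2] near the graph, and
   [1 / N <= nu] for the displacement of the graph. *)
pose N := 1 + `|K2| / nu + 2 * K / nu + nu^-1.
have nui : 0 <= nu^-1 by rewrite invr_ge0 ltW.
have N1 : 1 <= N.
  by rewrite /N -!addrA lerDl !addr_ge0// ?mulr_ge0// ?normr_ge0.
have N0 : 0 < N := lt_le_trans ltr01 N1.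
have invN (X : R) : X / nu <= N -> X * N^-1 <= nu.
  by rewrite ler_pdivrMr// ler_pdivrMr// mulrC.
have K2N : K2 * N^-1 <= nu.
  apply: invN; apply: (@le_trans _ _ (`|K2| / nu)); first by rewrite ler_wpM2r// ler_norm.
  by rewrite /N (addrC 1) -!addrA lerDl !addr_ge0// ?mulr_ge0.
have KN : 2 * K * N^-1 <= nu.
  apply: invN; rewrite /N (addrC _ (2 * K / nu)) -!addrA lerDl.
  by rewrite !addr_ge0// ?mulr_ge0.
have NN : 1 * N^-1 <= nu.
  apply: invN; rewrite mul1r /N addrC lerDl.
  by rewrite !addr_ge0// ?mulr_ge0.
pose T x := N * t x.
pose U x := (N / rho) * mu x.
have sT : smooth T := smooth_scale N st.
have sU : smooth U := smooth_scale (N / rho) smu.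
(* Bounded at scale [1 / N] on the whole cube. Near the new graph the profile turns it into
   [N * l - rho * C0 - rho * kappa * th T], that is, [N * (lambda - z)]. *)
pose E x := rho * (w (U x) - th (T x) * B (U x)) + lam i0 * tau (T x).
have swU := smooth_bounded_comp bw sU.
have sBU := smooth_bounded_comp bB sU.
have sDU := smooth_bounded_comp bD sU.
have sthT := smooth_bounded_comp bth sT.
have stauT := smooth_bounded_comp btau sT.
have sthB := smooth_mul sthT sBU.
have sE1 := smooth_sub swU sthB.
have sE2 := smooth_scale rho sE1.
have sE3 := smooth_scale (lam i0) stauT.
have sE : smooth E := smooth_add sE2 sE3.
pose e x := N ^- q / q`!%:R * E x ^+ q.
have se : smooth e := smooth_scale (N ^- q / q`!%:R) (smooth_pow q sE).
pose phi' x := phi x + N^-1 * D (U x).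
have Npow (X : R) (k : nat) : 0 <= X -> (0 < k)%N -> X * N <= X * N ^+ k.
  by move=> X0 k0; rewrite ler_wpM2l// -[leLHS]expr1 ler_weXn2l.
have bT p : cube p -> forall js, (0 < size js <= q)%N -> `|pd js T p| <= `|Ct| * N ^+ size js.
  move=> cp js /andP[j0 jq]; rewrite (pd_scale js N st) normrM (gtr0_norm N0) mulrC.
  apply: le_trans (Npow _ _ (normr_ge0 Ct) j0); rewrite ler_wpM2r ?(ltW N0)//.
  exact: le_trans (HCt p js cp jq) (ler_norm _).
have bU p : cube p -> forall js, (0 < size js <= q)%N -> `|pd js U p| <= `|Cmu / rho| * N ^+ size js.
  move=> cp js /andP[j0 jq]; rewrite (pd_scale js (N / rho) smu) normrM.
  apply: le_trans (Npow _ _ (normr_ge0 (Cmu / rho)) j0).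
  rewrite !normrM (gtr0_norm N0) mulrC mulrCA mulrC ler_wpM2r ?(ltW N0)// ler_wpM2r//.
  exact: le_trans (HCmu p js cp jq) (ler_norm _).
(* Stretched by [N], a distance [1 / (8 * N)] to the new graph becomes the [1/8] of the profile. *)
exists phi', e, (8 * N)^-1; split; [split|split].
- exact: smooth_add sphi (smooth_scale N^-1 sDU).
- exact: se.
- by rewrite invr_gt0 mulr_gt0.
- move=> x k.
  have tE : t (x + k *: delta_mx 0 i0) = t x + k.
    by rewrite /t iphi !mxE !eqxx mulr1; ring.
  have muE : mu (x + k *: delta_mx 0 i0) = mu x.
    by rewrite /mu tE /l linear_form_shift; ring.
  by rewrite /phi' /U iphi muE.
- move=> x; rewrite /phi' addrC addKr normrM ger0_norm; last by rewrite invr_ge0 (ltW N0).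
  have /andP[D0 D1] := D01 (U x).
  rewrite (ger0_norm D0) mulrC (le_trans _ NN)// ler_wpM2r ?invr_ge0 ?(ltW N0)//.
- move=> p js cp jq; rewrite /e.
  apply: le_trans (HK2 N p c E N1 sc sE _ _ js jq) K2N; first by move=> ks kq; exact: HCc.
  have N0' := ltW N0.
  have b1 := HKw N p U N0' sU (bU p cp).
  have b2 := HKB N p U N0' sU (bU p cp).
  have b3 := HKth N p T N0' sT (bT p cp).
  have b4 := HKtau N p T N0' sT (bT p cp).
  have b5 := scale_bound_sub swU sthB b1 (scale_bound_mul N0' sthT sBU b3 b2).
  exact: scale_bound_add sE2 sE3 (scale_bound_scale rho sE1 b5) (scale_bound_scale (lam i0) stauT b4).
move=> p js cp tube jq.
have tube' : `|T p - D (U p)| < 1/8.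
  have -> : T p - D (U p) = N * (p ord0 i0 - phi' p).
    by rewrite /T /t /phi'; field; rewrite gt_eqF.
  by rewrite normrM (gtr0_norm N0) -ltr_pdivlMl// (lt_le_trans tube)// invfM; lra.
have [C0 [kappa [delta [d0 k1 uC t2 Hloc]]]] := prof _ _ tube'.
have Erho : rho != 0 by rewrite gt_eqF.
have lE x : N * l x = rho * U x + lam i0 * T x.
  by rewrite /U /T /mu; field; rewrite Erho.
apply: (@le_trans _ _ (K * (N^-1 + rho))); last first.
  by rewrite mulrDr; move: KN Krho; rewrite -mulrA; lra.
apply: (HK rho N (rho * C0) kappa p c T E _ N1 k1 sc sT sE _ _ _ _ js jq).
- by rewrite (ltW rho0).
- move=> ks kq; apply: (le_trans (bT p cp ks kq)).
  rewrite ler_wpM2r ?exprn_ge0 ?(ltW N0)// /C -addrA addrCA lerDl addr_ge0//.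
- by move=> ks kq; exact: le_trans (HCc p ks cp kq) CcC.
- rewrite -/(l p) lE (_ : _ - _ = rho * (U p - C0) + lam i0 * T p); last by ring.
  rewrite (le_trans (ler_normD _ _))// (le_trans _ MC)// /M lerD// normrM.
    by rewrite (gtr0_norm rho0) mulr_ile1// ?(ltW rho0).
  by rewrite mulrC ler_wpM2r.
have cU : continuous U := smooth_continuous sU.
have cT : continuous T := smooth_continuous sT.
have /cvgrPdist_lt/(_ _ d0) nU := cU p.
have /cvgrPdist_lt/(_ _ d0) nT := cT p.
near=> x; have [||E1 E2] := Hloc (U x) (T x).
- by rewrite distrC; near: x; exact: nU.
- by rewrite distrC; near: x; exact: nT.
rewrite /E E1 E2 -/(l x) lE; ring.
Unshelve. all: by end_near. Qed.

End Wiggle.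

(** * All jets at once *)

Section Levels.
Context {R : realType} {m n : nat} (i0 : 'I_m) (O : set 'rV[R]_m).
Implicit Types (phi : 'rV[R]_m -> R) (p : 'rV[R]_m).

(** One wiggle serves a single linear form, so the terms are realized in succession; [jj] records
    the component of the target to which each belongs. The coefficients [c i] multiply the
    corrections, which therefore vanish on [O]. *)
Lemma wiggle_list (I : Type) (s : seq I) (jj : I -> 'I_n) (lam : I -> 'I_m -> R)
    (c : I -> 'rV[R]_m -> R) phi q (nu : R) :
  smooth phi -> vertically_invariant i0 phi -> (0 < q)%N -> 0 < nu ->
  (forall i, smooth (c i)) -> (forall i x, O x -> c i x = 0) ->
  exists phi' (g : 'I_n -> 'rV[R]_m -> R) (eta : R),
  [/\ smooth phi', vertically_invariant i0 phi', 0 < eta & forall x, `|phi' x - phi x| <= nu] /\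
  [/\ forall j, smooth (g j), forall j x, O x -> g j x = 0,
    forall p js j, cube p -> (size js < q)%N -> `|pd js (g j) p| <= nu &
    forall p js j, cube p -> `|p ord0 i0 - phi' p| < eta -> size js = q ->
      `|pd js (g j) p - \sum_(i <- s | jj i == j) c i p * \prod_(k <- js) lam i k| <= nu].
Proof.
move=> sphi iphi q0 nu0 sc cO; elim: s nu nu0 => [|i s IH] nu nu0.
  exists phi, (fun _ _ => 0), 1; split; split.
  - exact: sphi.
  - exact: iphi.
  - exact: ltr01.
  - by move=> x; rewrite subrr normr0 ltW.
  - by move=> j; exact: smooth_cst.
  - by [].
  - move=> p [|i js] j _ _; first by rewrite normr0 ltW.
    by rewrite pd_cst normr0 ltW.
  - move=> p [|i js] j _ _ _; rewrite big_nil subr0; first by rewrite normr0 ltW.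
    by rewrite pd_cst normr0 ltW.
have [|phi1 [g1 [eta1 [[sphi1 iphi1 eta10 phi1le] [sg1 g1O g1lo g1hi]]]]] := IH (nu / 2).
  by rewrite divr_gt0.
(* Half of the error budget and half of the tube already secured: points within [eta1 / 2] of the
   new graph are within [eta1] of the old one. *)
pose nu2 := Num.min (nu / 2) (eta1 / 2).
have nu20 : 0 < nu2 by rewrite lt_min !divr_gt0.
have nu2a : nu2 <= nu / 2 by rewrite ge_min lexx.
have nu2b : nu2 <= eta1 / 2 by rewrite ge_min lexx orbT.
have [phi2 [e [eta2 [[sphi2 se eta20 iphi2 phi2le] [elo ehi]]]]] :=
  wiggle_step (lam i) sphi1 (sc i) q0 nu20 iphi1.
have sce : smooth (fun x => c i x * e x) := smooth_mul (sc i) se.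
pose d j x := if jj i == j then c i x * e x else 0.
have sd j : smooth (d j).
  by rewrite /d; case: (jj i == j); [exact: sce|exact: smooth_cst].
exists phi2, (fun j x => g1 j x + d j x), (Num.min eta2 (eta1 / 2)); split; split.
- exact: sphi2.
- exact: iphi2.
- by rewrite lt_min eta20 divr_gt0.
- move=> x; rewrite -(subrKA (phi1 x)) (le_trans (ler_normD _ _))// [leRHS](splitr nu).
  by rewrite lerD// (le_trans (phi2le x)).
- by move=> j; exact: smooth_add (sg1 j) (sd j).
- by move=> j x Ox; rewrite g1O// /d cO// mul0r; case: ifP; rewrite addr0.
- move=> p js j cp jq; rewrite (pd_add js (sg1 j) (sd j)) (le_trans (ler_normD _ _))//.
  rewrite [leRHS](splitr nu) lerD//; first exact: g1lo.
  rewrite /d; case: (jj i == j); first by rewrite (le_trans (elo p js cp jq)).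
  by case: (js) => [|k ks]; rewrite ?pd_cst normr0 divr_ge0// ltW.
- move=> p js j cp; rewrite lt_min => /andP[t2 t1] jq.
  rewrite (pd_add js (sg1 j) (sd j)) big_cons.
  have t1' : `|p ord0 i0 - phi1 p| < eta1.
    rewrite -(subrKA (phi2 p)) (le_lt_trans (ler_normD _ _))// [ltRHS](splitr eta1).
    by rewrite ltr_leD// (le_trans (phi2le p)).
  have H1 := g1hi p js j cp t1' jq.
  set S := \sum_(_ <- _ | _) _ in H1 *.
  rewrite /d; case: (jj i == j).
    have -> : pd js (g1 j) p + pd js (fun x => c i x * e x) p - (c i p * \prod_(k <- js) lam i k + S) =
      (pd js (g1 j) p - S) + (pd js (fun x => c i x * e x) p - c i p * \prod_(k <- js) lam i k) by ring.
    rewrite (le_trans (ler_normD _ _))// [leRHS](splitr nu) lerD//.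
    exact: le_trans (ehi p js cp t2 jq) nu2a.
  rewrite (_ : pd js (fun=> 0) p = 0) ?addr0; last first.
    by case: (js) => [|k ks]; rewrite ?pd_cst.
  by rewrite (le_trans H1)// ler_pdivrMr// ler_peMr ?ler1n// ltW.
Qed.

(** Inverse of the Vandermonde matrix at the nodes [0, ..., q]: the weights pick out one exponent
    from the powers of the nodes. *)
Lemma node_weights q : exists W : 'I_q.+1 -> 'I_q.+1 -> R,
  forall d (a : nat), (a < q.+1)%N -> \sum_k W d k * k%:R ^+ a = (d == a :> nat)%:R.
Proof.
pose V : 'M[R]_q.+1 := Vandermonde q.+1 (\row_k k%:R).
have Vu : V \in unitmx.
  rewrite unitmxE unitfE det_Vandermonde; apply/prodf_neq0 => i _; apply/prodf_neq0 => j ij.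
  by rewrite !mxE subr_eq0 eqr_nat gtn_eqF.
exists (fun d k => invmx V k d) => d a aq.
have := congr1 (fun M : 'M[R]_q.+1 => M (Ordinal aq) d) (mulmxV Vu).
rewrite [RHS]mxE [LHS]mxE -val_eqE/= eq_sym => <-.
by apply: eq_bigr => k _; rewrite !mxE [LHS]mulrC.
Qed.

Definition seq_of_exponents (a : 'I_m -> nat) : seq 'I_m :=
  flatten [seq nseq (a i) i | i <- enum 'I_m].

Lemma pderE a (f : 'rV[R]_m -> R) : pder a f = pd (seq_of_exponents a) f.
Proof.
rewrite /pder /pd /seq_of_exponents map_flatten; congr (iderive (flatten _) f).
by rewrite -[RHS]map_comp; apply: eq_map => i /=; rewrite map_nseq.
Qed.

Lemma size_seq_of_exponents a : size (seq_of_exponents a) = mdeg a.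
Proof.
rewrite size_flatten /shape -map_comp sumnE big_map /mdeg big_enum/=.
by apply: eq_bigr => i _; rewrite /= size_nseq.
Qed.

Lemma prod_seq_of_exponents a (lam : 'I_m -> R) :
  \prod_(i <- seq_of_exponents a) lam i = \prod_i lam i ^+ a i.
Proof.
rewrite /seq_of_exponents big_flatten big_map big_enum /=; apply: eq_bigr => i _.
by rewrite big_nseq iter_mulr_1.
Qed.

Lemma exponent_le_mdeg (a : 'I_m -> nat) i : (a i <= mdeg a)%N.
Proof. by rewrite /mdeg (bigD1 i)//= leq_addr. Qed.

(** The derivative of [lambda ^ q / q!] along an exponent [a] of degree [q] is the product of the
    [lambda_i ^ a_i]. Taking forms with coefficients [v i] in [{0, ..., q}] and products of the
    one-variable weights isolates a single exponent [b]; a term is thus indexed by component,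
    exponent and node vector. *)
Lemma wiggle_level (T : 'I_n -> ('I_m -> nat) -> 'rV[R]_m -> R) phi q (nu : R) :
  smooth phi -> vertically_invariant i0 phi -> (0 < q)%N -> 0 < nu ->
  (forall j a, mdeg a = q -> smooth (T j a)) ->
  (forall j a x, mdeg a = q -> O x -> T j a x = 0) ->
  exists phi' (g : 'I_n -> 'rV[R]_m -> R) (eta : R),
  [/\ smooth phi', vertically_invariant i0 phi', 0 < eta & forall x, `|phi' x - phi x| <= nu] /\
  [/\ forall j, smooth (g j), forall j x, O x -> g j x = 0,
    forall p a j, cube p -> (mdeg a < q)%N -> `|pder a (g j) p| <= nu &
    forall p a j, cube p -> `|p ord0 i0 - phi' p| < eta -> mdeg a = q ->
      `|pder a (g j) p - T j a p| <= nu].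
Proof.
move=> sphi iphi q0 nu0 sT TO; have [W HW] := node_weights q.
pose mi := {ffun 'I_m -> 'I_q.+1}.
pose ex (b : mi) : 'I_m -> nat := fun i => b i.
pose I : finType := ('I_n * mi * mi)%type.
(* Exponents [b] of other degrees occur in the index type as well and get coefficient [0], since [T]
   is controlled only in degree [q]. *)
pose c (k : I) x := (\prod_i W (k.1.2 i) (k.2 i)) * (if mdeg (ex k.1.2) == q then T k.1.1 (ex k.1.2) x else 0).
pose lam (k : I) i : R := (k.2 i)%:R.
have sc k : smooth (c k).
  apply: smooth_scale; case: eqP => [H|_]; first exact: (sT k.1.1 _ H).
  exact: smooth_cst.
have cO k x : O x -> c k x = 0.
  by move=> Ox; rewrite /c; case: eqP => [/TO->|_]; rewrite ?mulr0.
have [phi' [g [eta [P1 [sg gO glo ghi]]]]] :=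
  wiggle_list (index_enum I) (fun k => k.1.1) lam sphi iphi q0 nu0 sc cO.
exists phi', g, eta; split; [exact: P1|split; [exact: sg|exact: gO| |]].
  by move=> p a j cp aq; rewrite pderE; apply: glo; rewrite ?size_seq_of_exponents.
move=> p a j cp tube aq; rewrite pderE.
have := ghi p (seq_of_exponents a) j cp tube; rewrite size_seq_of_exponents => /(_ aq).
rewrite (_ : \sum_(_ <- _ | _) _ = T j a p)//.
have aq1 i : (a i < q.+1)%N by rewrite ltnS -aq exponent_le_mdeg.
pose a' : mi := [ffun i => Ordinal (aq1 i)].
have a'E : ex a' = a by apply/funext => i; rewrite /ex ffunE.
transitivity (\sum_(b : mi) \sum_(v : mi) c (j, b, v) p * \prod_i (v i)%:R ^+ a i).
  rewrite pair_big /= (reindex_onto (fun bv : mi * mi => (j, bv.1, bv.2) : I) (fun k => (k.1.2, k.2))) /=; last first.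
    by move=> [[j' b] v] /= /eqP->.
  rewrite (eq_bigl xpredT) => [|[b v]]; last by rewrite /= !eqxx.
  by apply: eq_bigr => -[b v] _; rewrite prod_seq_of_exponents.
have cE b : \sum_(v : mi) c (j, b, v) p * \prod_i (v i)%:R ^+ a i =
    (if mdeg (ex b) == q then T j (ex b) p else 0) * (b == a')%:R.
  have -> : (b == a')%:R = \prod_i \sum_k W (b i) k * k%:R ^+ a i :> R.
    transitivity (\prod_i (b i == a i :> nat)%:R : R).
      have [->|ba] := eqVneq b a'.
        by rewrite big1// => i _; rewrite ffunE eqxx.
      have [i bi] : exists i, b i != a' i.
        apply/existsP; apply: contraNT ba; rewrite negb_exists => /forallP H.
        by apply/eqP/ffunP => i; have := H i; rewrite negbK => /eqP.
      rewrite (bigD1 i)//= (_ : (b i == a i :> nat) = false) ?mul0r//.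
      by apply: contraNF bi => /eqP H; apply/eqP/val_inj; rewrite ffunE.
    by apply: eq_bigr => i _; rewrite HW.
  rewrite bigA_distr_bigA /= mulr_sumr; apply: eq_bigr => v _.
  by rewrite big_split /= /c /=; ring.
rewrite (eq_bigr _ (fun b _ => cE b)) (bigD1 a')//= big1 ?addr0 => [|b /negPf->]; last by rewrite mulr0.
by rewrite a'E aq !eqxx mulr1.
Qed.

(** Here [S] prescribes partial derivatives rather than Taylor coefficients. At each order the
    residual [S - pder a h] of exactly that order is realized; its realization is small in all lower
    orders, so it spoils neither the earlier approximations nor the bound up to order [l]. *)
Lemma holonomic_approximation (S : 'I_n -> ('I_m -> nat) -> 'rV[R]_m -> R) (l r : nat) (nu : R) :
  (forall j a, (mdeg a <= r)%N -> smooth (S j a)) ->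
  (forall j a x, (mdeg a <= r)%N -> O x -> S j a x = 0) ->
  (forall j a p, cube p -> (mdeg a <= l)%N -> S j a p = 0) -> (l <= r)%N -> open O -> 0 < nu ->
  exists phi (h : 'I_n -> 'rV[R]_m -> R) (eta : R),
  [/\ smooth phi, vertically_invariant i0 phi, 0 < eta & forall x, `|phi x| <= nu] /\
  [/\ forall j, smooth (h j), forall j x, O x -> h j x = 0,
    forall p a j, cube p -> (mdeg a <= l)%N -> `|pder a (h j) p| <= nu &
    forall p a j, cube p -> `|p ord0 i0 - phi p| < eta -> (mdeg a <= r)%N ->
      `|pder a (h j) p - S j a p| <= nu].
Proof.
move=> sS SO Sl lr oO.
(* The tolerance varies in the induction, since the orders below must leave half of it to the new
   correction. *)
suff H d : (l + d <= r)%N -> forall nu : R, 0 < nu ->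
  exists phi (h : 'I_n -> 'rV[R]_m -> R) (eta : R),
  [/\ smooth phi, vertically_invariant i0 phi, 0 < eta & forall x, `|phi x| <= nu] /\
  [/\ forall j, smooth (h j), forall j x, O x -> h j x = 0,
    forall p a j, cube p -> (mdeg a <= l)%N -> `|pder a (h j) p| <= nu &
    forall p a j, cube p -> `|p ord0 i0 - phi p| < eta -> (mdeg a <= l + d)%N ->
      `|pder a (h j) p - S j a p| <= nu].
  by move=> nu0; have := H (r - l)%N; rewrite subnKC// => /(_ (leqnn r) nu nu0).
elim: d => [|d IH] dr {}nu nu0.
  have z js p : pd js (fun=> 0) p = 0 :> R by case: js => [|i js]; rewrite ?pd_cst.
  exists (fun=> 0), (fun _ _ => 0), 1; split; split.
  - exact: smooth_cst.
  - by [].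
  - exact: ltr01.
  - by move=> x; rewrite normr0 ltW.
  - by move=> j; exact: smooth_cst.
  - by [].
  - by move=> p a j _ _; rewrite pderE z normr0 ltW.
  - by move=> p a j cp _; rewrite addn0 => al; rewrite pderE z Sl// subr0 normr0 ltW.
have nu2 : 0 < nu / 2 by rewrite divr_gt0.
have dr' : (l + d <= r)%N by rewrite (leq_trans _ dr)// leq_add2l.
have [phi [h [eta [[sphi iphi eta0 phile] [sh hO hlo hhi]]]]] := IH dr' _ nu2.
pose q := (l + d.+1)%N.
have q0 : (0 < q)%N by rewrite /q addnS.
pose T j a x := S j a x - pder a (h j) x.
have sp j a : smooth (pder a (h j)) by rewrite pderE; exact: smooth_pd (sh j).
have sT j a : mdeg a = q -> smooth (T j a).
  by move=> aq; apply: smooth_sub (sS j a _) (sp j a); rewrite aq.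
have TO j a x : mdeg a = q -> O x -> T j a x = 0.
  move=> aq Ox; rewrite /T SO ?aq// sub0r pderE.
  have nO : \forall y \near x, h j y = 0.
    by have := open_nbhs_nbhs (conj oO Ox); apply: filterS => y; exact: hO.
  by rewrite (near_pd _ nO); case: (seq_of_exponents a) => [|i js]; rewrite ?pd_cst oppr0.
pose nu3 := Num.min (nu / 2) (eta / 2).
have nu30 : 0 < nu3 by rewrite lt_min nu2 divr_gt0.
have nu3a : nu3 <= nu / 2 by rewrite ge_min lexx.
have nu3b : nu3 <= eta / 2 by rewrite ge_min lexx orbT.
have [phi' [g [eta' [[sphi' iphi' eta'0 phi'le] [sg gO glo ghi]]]]] :=
  wiggle_level sphi iphi q0 nu30 sT TO.
have pdD j a p : pder a (fun x => h j x + g j x) p = pder a (h j) p + pder a (g j) p.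
  by rewrite !pderE (pd_add _ (sh j) (sg j)).
exists phi', (fun j x => h j x + g j x), (Num.min eta' (eta / 2)); split; split.
- exact: sphi'.
- exact: iphi'.
- by rewrite lt_min eta'0 divr_gt0.
- move=> x; rewrite -[phi' x](subrK (phi x)) (le_trans (ler_normD _ _))// [leRHS](splitr nu).
  by rewrite lerD// (le_trans (phi'le x)).
- by move=> j; exact: smooth_add (sh j) (sg j).
- by move=> j x Ox; rewrite hO// gO// addr0.
- move=> p a j cp al; rewrite pdD (le_trans (ler_normD _ _))// [leRHS](splitr nu).
  by rewrite lerD ?hlo// (le_trans _ nu3a)// glo// /q addnS ltnS (leq_trans al)// leq_addr.
- move=> p a j cp; rewrite lt_min => /andP[t' t] aq; rewrite pdD.
  have t1 : `|p ord0 i0 - phi p| < eta.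
    rewrite -(subrKA (phi' p)) (le_lt_trans (ler_normD _ _))// [ltRHS](splitr eta).
    by rewrite ltr_leD// (le_trans (phi'le p)).
  have [aq'|aq'] := eqVneq (mdeg a) q.
    have := ghi p a j cp t' aq'; rewrite /T => H.
    rewrite (_ : _ - S j a p = pder a (g j) p - (S j a p - pder a (h j) p)); last by ring.
    by rewrite (le_trans H)// (le_trans nu3a)// ler_pdivrMr// ler_peMr ?ler1n// ltW.
  have aq2 : (mdeg a < q)%N by rewrite ltn_neqAle aq'.
  rewrite addrAC (le_trans (ler_normD _ _))// [leRHS](splitr nu) lerD//.
    by apply: hhi => //; move: aq2; rewrite /q addnS ltnS.
  by rewrite (le_trans _ nu3a)// glo.
Qed.

End Levels.

(** * Vertical isotopies *)

Section InverseAlongDirection.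
Context {R : realType} {V : normedModType R} (e : V).

Lemma is_derive_line (g : V -> R) (z w : V) (s : R) : smooth g ->
  is_derive s (1 : R) (fun s => g (s *: w + z)) ('D_w g (s *: w + z)).
Proof.
move=> sg; have E : (fun h : R => h^-1 *: (((fun s => g (s *: w + z)) \o shift s) (h *: (1:R)) - g (s *: w + z)))
   = (fun h : R => h^-1 *: ((g \o shift (s *: w + z)) (h *: w) - g (s *: w + z))).
  by apply/funext => h /=; rewrite [h *: 1]mulr1 scalerDl addrA.
have d := smooth_derivable (s *: w + z) w sg.
by split; rewrite /derivable /derive E.
Qed.

(** Keeps a difference exact while its base point moves, as happens below where both [z] and [k]
    vary with the increment. *)
Lemma directional_MVT (g : V -> R) (z w : V) (k : R) : smooth g ->
  exists2 s, `|s| <= `|k| & g (k *: w + z) - g z = k * 'D_w g (s *: w + z).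
Proof.
move=> sg; pose f s := g (s *: w + z).
have fd s : is_derive s (1 : R) f ('D_w g (s *: w + z)) := is_derive_line z w s sg.
have fc (a b : R) : {within `[a, b], continuous f}.
  apply: continuous_subspaceT => s; apply: derivable_continuous1.
  exact: (is_derive_derivable (fd s)).
have f0 : f 0 = g z by rewrite /f scale0r add0r.
have [k0|k0] := leP 0 k.
  have [s sk Hs] := MVT_segment k0 (fun s _ => fd s) (fc 0 k).
  exists s; last by rewrite -f0 [LHS]Hs subr0 mulrC.
  by move: sk; rewrite in_itv /= => /andP[s0 sk]; rewrite !ger0_norm.
have [s sk Hs] := MVT_segment (ltW k0) (fun s _ => fd s) (fc k 0).
exists s; last by rewrite -f0 -opprB [X in - X]Hs sub0r mulrN opprK mulrC.
by move: sk; rewrite in_itv /= => /andP[sk s0]; rewrite !ler0_norm ?lerN2// ltW.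
Qed.

Context (u : V -> R) (G : V -> V) (gam : V -> R) (su : smooth u)
  (u_lip : forall x (k : R), `|u (k *: e + x) - u x| <= `|k| / 2)
  (gamP : forall y, gam y + u (gam y *: e + y) = 0)
  (GE : forall y, G y = gam y *: e + y).

Lemma vertical_slope x : `|'D_e u x| <= 1/2.
Proof.
have d := smooth_derivable x e su.
have c : (fun h : R => `|h^-1 *: ((u \o shift x) (h *: e) - u x)|) @ 0^' --> `|'D_e u x|.
  exact: (@cvg_norm _ _ _ _ _ _ _ d).
rewrite -(cvg_lim _ c)//; apply: limr_le; first by apply/cvg_ex; exists `|'D_e u x|.
near=> h; have h0 : h != 0 by near: h; exact: nbhs_dnbhs_neq.
rewrite /= normrM normfV ler_pdivrMl ?normr_gt0// (le_trans (u_lip _ _))//.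
by rewrite mul1r.
Unshelve. all: by end_near. Qed.

(** Subtract the equations at [y] and [y']: the vertical variation of [u] absorbs at most half of
    [gam y' - gam y], and the rest is the variation of [u] with [gam y] frozen. *)
Lemma gam_continuous : continuous gam.
Proof.
have key y y' : `|gam y' - gam y| <= 2 * `|u (gam y *: e + y') - u (gam y *: e + y)|.
  have := u_lip (gam y *: e + y') (gam y' - gam y).
  rewrite addrA -scalerDl subrK.
  have e1 := gamP y; have e2 := gamP y'.
  set a := u (gam y' *: e + y') in e2 *; set b := u (gam y *: e + y').
  set c := u (gam y *: e + y) in e1 *.
  have -> : a = - gam y' by lra.
  have -> : c = - gam y by lra.
  set d := gam y' - gam y => H.
  have : `|d| <= `|- gam y' - b| + `|b - - gam y|.
    by rewrite -normrN /d (_ : - (_ - _) = (- gam y' - b) + (b - - gam y)) ?ler_normD//; ring.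
  lra.
move=> y; apply/cvgrPdist_lt => eps eps0.
have cu : continuous u := smooth_continuous su.
have ca : continuous (fun y' : V => gam y *: e + y').
  by move=> z; apply: cvgD; [exact: cvg_cst|exact: cvg_id].
have /cvgrPdist_lt/(_ (eps / 2)) : (fun y' => u (gam y *: e + y')) @ y --> u (gam y *: e + y).
  exact: (continuous_comp (ca y) (cu _)).
rewrite divr_gt0// => /(_ isT); apply: filterS => y' H.
rewrite distrC (le_lt_trans (key y y'))// distrC mulrC -ltr_pdivlMr//.
Qed.

Lemma G_continuous : continuous G.
Proof.
have -> : G = fun y => gam y *: e + y by apply/funext.
move=> y; apply: cvgD; last exact: cvg_id.
have cg : continuous gam := gam_continuous.
exact: (cvgZr_tmp (cg y)).
Qed.

Lemma one_plus_slope_neq0 x : 1 + 'D_e u x != 0.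
Proof.
have := vertical_slope x; rewrite ler_norml => /andP[h _].
by rewrite gt_eqF//; lra.
Qed.

(* Implicit differentiation of [gam y + u (G y) = 0]. *)
Definition gam_slope w x := - 'D_w u x / (1 + 'D_e u x).

Lemma smooth_gam_slope w : smooth (gam_slope w).
Proof.
have s1 : smooth (fun x => 1 + 'D_e u x) := smooth_add (smooth_cst (1 : R)) (smooth_derive e su).
exact: smooth_mul (smooth_opp (smooth_derive w su)) (smooth_inv one_plus_slope_neq0 s1).
Qed.

(** Moving [y] by [h *: w] moves [x = G y] by [h *: w] and then vertically by [k h]. The vertical
    part is exact by the mean value theorem: for [u] it determines the limit of [k h / h], and for
    [g] it then gives the chain rule. *)
Lemma is_derive_comp_G (g : V -> R) y w : smooth g ->
  is_derive y w (fun y => g (G y)) ('D_w g (G y) + gam_slope w (G y) * 'D_e g (G y)).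
Proof.
move=> sg; pose x := G y; pose k (h : R) := gam (h *: w + y) - gam y.
have GhE h : G (h *: w + y) = k h *: e + (h *: w + x).
  by rewrite /x !GE /k scalerBl (addrCA (h *: w)) [RHS]addrA subrK.
have h0 : (fun h : R => h) @ 0^' --> (0 : R) by exact: cvg_within.
have hw0 : (fun h : R => h *: w) @ 0^' --> (0 : V).
  by rewrite -(scale0r w); exact: cvgZr_tmp.
have k0 : k h @[h --> 0^'] --> (0 : R).
  have ca : (fun h : R => h *: w + y) @ 0^' --> y.
    by rewrite -{2}[y]add0r; apply: cvgD; [exact: hw0|exact: cvg_cst].
  have cg : continuous gam := gam_continuous.
  have H : (fun h : R => gam (h *: w + y)) @ 0^' --> gam y by exact: continuous_cvg (cg y) ca.
  rewrite /k -[X in _ --> X](subrr (gam y)); apply: cvgB; [exact: H|exact: cvg_cst].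
have slopes (f : V -> R) (sf : smooth f) : exists2 S : R -> R,
    (fun h => 'D_e f (S h *: e + (h *: w + x))) @ 0^' --> 'D_e f x &
    forall h, f (G (h *: w + y)) - f (h *: w + x) = k h * 'D_e f (S h *: e + (h *: w + x)).
  have /choice[S HS] : forall h, exists s, `|s| <= `|k h| /\
     f (k h *: e + (h *: w + x)) - f (h *: w + x) = k h * 'D_e f (s *: e + (h *: w + x)).
    by move=> h; have [s ? ?] := directional_MVT (h *: w + x) e (k h) sf; exists s.
  exists S; last by move=> h; rewrite GhE; exact: (HS h).2.
  have S0 : S h @[h --> 0^'] --> (0 : R).
    apply/cvgr0Pnorm_lt => eps eps0; have /cvgr0Pnorm_lt/(_ _ eps0) := k0.
    by apply: filterS => h; apply: le_lt_trans; exact: (HS h).1.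
  have cD : continuous (fun x => 'D_e f x) := smooth_continuous (smooth_derive e sf).
  apply: (continuous_cvg _ (cD x)).
  have Se0 : (fun h : R => S h *: e) @ 0^' --> (0 : V).
    by rewrite -(scale0r e); exact: cvgZr_tmp.
  rewrite -[X in _ --> X]add0r -[X in _ --> _ + X]add0r; apply: cvgD; first exact: Se0.
  by apply: cvgD; [exact: hw0|exact: cvg_cst].
have quot (f : V -> R) (sf : smooth f) :
    (fun h : R => h^-1 * (f (h *: w + x) - f x)) @ 0^' --> 'D_w f x.
  exact: (smooth_derivable x w sf).
have [Su Du Eu] := slopes u su.
have [Sg Dg Eg] := slopes g sg.
have kslope : (fun h : R => h^-1 * k h) @ 0^' --> gam_slope w x.
  have c1 : (fun h => 1 + 'D_e u (Su h *: e + (h *: w + x))) @ 0^' --> 1 + 'D_e u x.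
    by apply: cvgD => //; exact: cvg_cst.
  have c2 : (fun h => (1 + 'D_e u (Su h *: e + (h *: w + x)))^-1) @ 0^' --> (1 + 'D_e u x)^-1.
    by apply: cvgV; [exact: one_plus_slope_neq0|exact: c1].
  have c3 : (fun h => - (h^-1 * (u (h *: w + x) - u x)) * (1 + 'D_e u (Su h *: e + (h *: w + x)))^-1)
      @ 0^' --> gam_slope w x.
    by apply: cvgM; [apply: cvgN; exact: quot|exact: c2].
  suff -> : (fun h : R => h^-1 * k h) =
    (fun h => - (h^-1 * (u (h *: w + x) - u x)) * (1 + 'D_e u (Su h *: e + (h *: w + x)))^-1).
    exact: c3.
  apply/funext => h.
  have := Eu h; set d := 'D_e u _.
  have d0 : 1 + d != 0 := one_plus_slope_neq0 _.
  have eG : u (G (h *: w + y)) = - gam (h *: w + y).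
    by have := gamP (h *: w + y); rewrite -GE => H; lra.
  have ex : u x = - gam y by have := gamP y; rewrite -GE -/x => H; lra.
  rewrite eG ex => E.
  have -> : u (h *: w + x) - - gam y = - (k h * (1 + d)).
    by rewrite mulrDr mulr1 -E /k; ring.
  by rewrite mulrN opprK mulrA mulfK.
have C : (fun h : R => h^-1 *: (((fun y => g (G y)) \o shift y) (h *: w) - g (G y))) @ 0^' -->
    'D_w g x + gam_slope w x * 'D_e g x.
  have c4 : (fun h => h^-1 * (g (h *: w + x) - g x) + h^-1 * k h * 'D_e g (Sg h *: e + (h *: w + x)))
      @ 0^' --> 'D_w g x + gam_slope w x * 'D_e g x.
    by apply: cvgD; [exact: quot|apply: cvgM; [exact: kslope|exact: Dg]].
  suff -> : (fun h : R => h^-1 *: (((fun y => g (G y)) \o shift y) (h *: w) - g (G y))) =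
    (fun h => h^-1 * (g (h *: w + x) - g x) + h^-1 * k h * 'D_e g (Sg h *: e + (h *: w + x))).
    exact: c4.
  apply/funext => h.
  by rewrite /= -mulrA -Eg -/x /GRing.scale/=; ring.
by split; [apply/cvg_ex; eexists; exact: C|exact: cvg_lim].
Qed.

(** The slope of [gam] is a smooth function evaluated at [G y], so a derivative of [g (G y)] is
    again a smooth function of [G y], and the class is stable. *)
Lemma smooth_comp_G (g : V -> R) : smooth g -> smooth (fun y => g (G y)).
Proof.
move=> sg.
apply: (@smooth_coind _ _ _ (fun f : V -> R => exists2 g, smooth g & f = fun y => g (G y)));
  last by exists g.
- move=> _ [f sf ->] y; apply: continuous_comp; first exact: G_continuous.
  exact: smooth_continuous.
- by move=> _ [f sf ->] v y; exact: (is_derive_derivable (is_derive_comp_G y v sf)).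
- move=> _ [f sf ->] v; exists (fun x => 'D_v f x + gam_slope v x * 'D_e f x).
    exact: smooth_add (smooth_derive v sf) (smooth_mul (smooth_gam_slope v) (smooth_derive e sf)).
  by apply/funext => y; exact: (is_derive_val (is_derive_comp_G y v sf)).
Qed.

End InverseAlongDirection.

(** Intermediate values on [[- M, M]] with [M = 2 * |u y|]: moving by [M] changes [u] by at most
    [|u y|], so the summand [s] decides the signs at both ends. *)
Lemma shift_inverse_exists (R : realType) (V : normedModType R) (e : V) (u : V -> R) :
  smooth u -> (forall x (k : R), `|u (k *: e + x) - u x| <= `|k| / 2) ->
  exists gam, forall y, gam y + u (gam y *: e + y) = 0.
Proof.
move=> su ulip.
suff /choice[gam gamP] : forall y, exists s, s + u (s *: e + y) = 0 by exists gam.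
move=> y; pose M := 2 * `|u y|.
have M0 : 0 <= M by rewrite mulr_ge0.
have M1 : - M <= M by lra.
have fc : {within `[- M, M], continuous (fun s => s + u (s *: e + y))}.
  apply: continuous_subspaceT => s; apply: derivable_continuous1.
  exact: (is_derive_derivable (is_deriveD (is_derive_id s (1 : R)) (is_derive_line y e s su))).
have H1 := ulip y M; have H2 := ulip y (- M).
rewrite normrN (ger0_norm M0) in H2; rewrite (ger0_norm M0) in H1.
have N1 := ler_norm (u y); have N2 := ler_norm (- u y); rewrite normrN in N2.
move: H1 H2; rewrite !ler_norml => /andP[H1 H1'] /andP[H2 H2'].
rewrite /M in H1 H1' H2 H2'.
have [|s _ Hs] := IVT M1 fc (v := 0); last by exists s.
rewrite ge_min le_max; apply/andP; split; apply/orP; [left|right]; rewrite /M; lra.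
Qed.

Lemma shift_injective (R : realType) (V : normedModType R) (e : V) (u : V -> R) y (a b : R) :
  (forall x (k : R), `|u (k *: e + x) - u x| <= `|k| / 2) ->
  a + u (a *: e + y) = b + u (b *: e + y) -> a = b.
Proof.
move=> ulip E; have := ulip (b *: e + y) (a - b); rewrite addrA -scalerDl subrK => H.
have : `|a - b| <= `|a - b| / 2.
  by rewrite -[leLHS]normrN (_ : - (a - b) = u (a *: e + y) - u (b *: e + y))//; lra.
by move=> H2; apply/eqP; rewrite -subr_eq0 -normr_le0; lra.
Qed.

(** * Isotopies of the cube along one coordinate *)

Section VerticalIsotopy.
Context {R : realType} {m : nat} (i0 : 'I_m).
Local Notation e := (delta_mx 0 i0 : 'rV[R]_m).

Lemma vertical_coord (x : 'rV[R]_m) (k : R) : (x + k *: e) ord0 i0 = x ord0 i0 + k.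
Proof. by rewrite !mxE !eqxx mulr1. Qed.

Lemma vertical_coord_neq (x : 'rV[R]_m) (k : R) i : i != i0 -> (x + k *: e) ord0 i = x ord0 i.
Proof. by move=> ii; rewrite !mxE (negbTE ii) andbF mulr0 addr0. Qed.

Lemma vertical_isotopy (v : 'rV[R]_m -> R) : smooth v ->
  (forall x (k : R), `|v (k *: e + x) - v x| <= `|k| / 2) ->
  (forall x : 'rV[R]_m, 1 <= `|x ord0 i0| -> v x = 0) ->
  isotopy (fun tx : R * 'rV[R]_m => tx.2 + (tx.1 * v tx.2) *: e).
Proof.
move=> sv vlip v0; split; [|split].
- have s1 : smooth (fun tx : R * 'rV[R]_m => tx.1) by apply: smooth_linear => // x; exact: cvg_fst.
  have c2 : continuous (fun tx : R * 'rV[R]_m => tx.2) by move=> x; exact: cvg_snd.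
  have sv2 : smooth (fun tx : R * 'rV[R]_m => v tx.2) by exact: (smooth_precomp c2 _ sv).
  apply: smooth_mx => i.
  have -> : (fun tx : R * 'rV[R]_m => (tx.2 + (tx.1 * v tx.2) *: e) ord0 i) =
      (fun tx => tx.2 ord0 i + e ord0 i * (tx.1 * v tx.2)).
    by apply/funext => tx; rewrite mxE [X in _ + X]mxE mulrC.
  have sc : smooth (fun tx : R * 'rV[R]_m => tx.2 ord0 i) by exact: (smooth_precomp c2 _ (smooth_coord i)).
  exact: smooth_add sc (smooth_scale _ (smooth_mul s1 sv2)).
- by move=> x; rewrite /= mul0r scale0r addr0.
move=> t /andP[t0 t1]; pose u x := t * v x.
have su : smooth u := smooth_scale t sv.
have ulip x k : `|u (k *: e + x) - u x| <= `|k| / 2.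
  by rewrite -mulrBr normrM ger0_norm// (le_trans _ (vlip x k))// ler_piMl.
have u0 (x : 'rV[R]_m) : 1 <= `|x ord0 i0| -> u x = 0 by move=> /v0 vx; rewrite /u vx mulr0.
have cubeF x : cube x -> cube (x + u x *: e).
  move=> cx i; have [->|ii] := eqVneq i i0; last by rewrite vertical_coord_neq.
  rewrite vertical_coord; have := cx i0; rewrite ler_norml => /andP[h1 h2].
  (* Compare with the points of the two faces on the same vertical, where [u] vanishes: [|u x|] is
     at most half the distance to either face. *)
  have up : u ((1 - x ord0 i0) *: e + x) = 0.
    by apply: u0; rewrite addrC vertical_coord addrC subrK normr1.
  have dn : u ((-1 - x ord0 i0) *: e + x) = 0.
    by apply: u0; rewrite addrC vertical_coord addrC subrK normrN1.
  have := ulip x (1 - x ord0 i0); have := ulip x (-1 - x ord0 i0).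
  rewrite up dn !sub0r normrN [`|1 - _|]ger0_norm ?[`|-1 - _|]ler0_norm; [|lra|lra].
  rewrite !ler_norml => /andP[h3 h4] /andP[h5 h6].
  by apply/andP; split; lra.
split; first exact: cubeF.
have [gam gamP] := shift_inverse_exists su ulip.
pose G y := gam y *: e + y.
have GE y : G y = gam y *: e + y by [].
have FG y : G y + u (G y) *: e = y.
  rewrite {1}/G addrAC -scalerDl.
  by rewrite (gamP y) scale0r add0r.
have GF x : G (x + u x *: e) = x.
  have gE : gam (x + u x *: e) = - u x.
    apply: (shift_injective (y := x + u x *: e) ulip).
    by rewrite gamP scaleNr addrCA addNr addr0 addNr.
  by rewrite /G gE scaleNr addrCA addNr addr0.
exists G; split.
  apply: smooth_mx => i.
  exact: (smooth_comp_G su ulip gamP GE (smooth_coord i)).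
split; last by split=> [x _|y _]; [exact: GF|exact: FG].
move=> y cy i; have [->|ii] := eqVneq i i0; last first.
  by have := cy i; rewrite -{1}(FG y) vertical_coord_neq.
(* A preimage beyond the faces would not be moved, hence would equal [y], which lies in the cube. *)
rewrite leNgt; apply/negP => G1.
have := FG y; rewrite (u0 _ (ltW G1)) scale0r addr0 => E.
by move: G1; rewrite E ltNge cy.
Qed.

End VerticalIsotopy.

(** * Cutoff functions *)

Section Cutoff.
Context {R : realType} {m : nat}.

Lemma bounded_smooth_lipschitz (s : R -> R) : bounded_smooth s ->
  exists2 L, 0 < L & forall a b, `|s a - s b| <= L * `|a - b|.
Proof.
move=> [d [jd bd] <-]; have [S HS] := bd 1%N.
exists (`|S| + 1) => [|a b]; first by rewrite ltr_wpDl.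
wlog ba : a b / b <= a.
  by move=> H; have [/H//|/ltW/H] := leP b a; rewrite distrC [X in _ -> _ <= _ * X]distrC.
have fc : {within `[b, a], continuous (d 0%N)}.
  apply: continuous_subspaceT => x; apply: derivable_continuous1.
  exact: (is_derive_derivable (jd 0%N x)).
have [c _ ->] := MVT_segment ba (fun x _ => jd 0%N x) fc.
by rewrite normrM ler_wpM2r// (le_trans (HS c))// (le_trans (ler_norm _))// lerDl ler01.
Qed.

(** A product of steps in the distances to the faces, rescaled by [kap]; [3/8] and [5/8] are the
    thresholds of the step. Along one coordinate only two factors vary, which gives the constant
    [2 * L0 / kap]. *)
Lemma exists_cutoff (kap : R) : 0 < kap -> exists (chi : 'rV[R]_m -> R) (L : R),
  [/\ smooth chi, 0 < L, forall x, `|chi x| <= 1,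
    forall x i (k : R), `|chi (k *: delta_mx 0 i + x) - chi x| <= L * `|k| &
  (forall x : 'rV[R]_m, (forall i, `|x ord0 i| <= 1 - 5/8 * kap) -> chi x = 1) /\
  (forall (x : 'rV[R]_m) i, 1 - 3/8 * kap <= `|x ord0 i| -> chi x = 0)].
Proof.
move=> k0; have [d [bd d0 d1 d01]] := @exists_step R.
pose th := d 0%N; have bth : bounded_smooth th by exists d.
have [L0 L00 HL] := bounded_smooth_lipschitz bth.
pose cut (z : R) := th (kap^-1 * z + kap^-1) * th ((- kap^-1) * z + kap^-1).
have th01 z : 0 <= th z <= 1 := d01 z.
have cut01 z : 0 <= cut z <= 1.
  have /andP[a0 a1] := th01 (kap^-1 * z + kap^-1).
  have /andP[b0 b1] := th01 ((- kap^-1) * z + kap^-1).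
  by rewrite /cut mulr_ge0//= mulr_ile1.
pose chi (x : 'rV[R]_m) := \prod_i cut (x ord0 i).
have chi01 (P : pred 'I_m) (x : 'rV[R]_m) : 0 <= \prod_(i | P i) cut (x ord0 i) <= 1.
  elim/big_ind: _ => [|a b /andP[a0 a1] /andP[b0 b1]|i _]; first by rewrite ler01 lexx.
    by rewrite mulr_ge0//= mulr_ile1.
  exact: cut01.
have cutlip z w : `|cut z - cut w| <= 2 * L0 / kap * `|z - w|.
  rewrite /cut; set a := th _; set b := th _; set a' := th _; set b' := th _.
  have /andP[b0 b1] := th01 ((- kap^-1) * z + kap^-1).
  have /andP[a0 a1] := th01 (kap^-1 * w + kap^-1).
  have -> : a * b - a' * b' = (a - a') * b + a' * (b - b') by ring.
  rewrite (le_trans (ler_normD _ _))// !normrM.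
  have ki : `|kap^-1| = kap^-1 by rewrite ger0_norm// invr_ge0 ltW.
  have Ha : `|a - a'| <= L0 * (kap^-1 * `|z - w|).
    rewrite (le_trans (HL _ _))// -ki -normrM.
    by rewrite (_ : _ - _ = kap^-1 * (z - w)) ?ki//; ring.
  have Hb : `|b - b'| <= L0 * (kap^-1 * `|z - w|).
    rewrite (le_trans (HL _ _))// -ki -normrM -[X in _ <= L0 * X]normrN.
    by rewrite (_ : _ - _ = - (kap^-1 * (z - w))) ?ki//; ring.
  have -> : 2 * L0 / kap * `|z - w| = L0 * (kap^-1 * `|z - w|) + L0 * (kap^-1 * `|z - w|) by ring.
  rewrite lerD//.
    by rewrite -[leRHS]mulr1 ler_pM// ger0_norm.
  by rewrite -[leRHS]mul1r ler_pM// ger0_norm.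
have ki0 : 0 < kap^-1 by rewrite invr_gt0.
have kN z : (- kap^-1) * z + kap^-1 = kap^-1 * (1 - z) by ring.
have kP z : kap^-1 * z + kap^-1 = kap^-1 * (1 + z) by ring.
exists chi, (2 * L0 / kap); split.
- apply: smooth_prod => i.
  exact: smooth_mul (smooth_bounded_comp (bounded_smooth_affine _ _ bth) (smooth_coord i))
                    (smooth_bounded_comp (bounded_smooth_affine _ _ bth) (smooth_coord i)).
- by rewrite divr_gt0// mulr_gt0.
- by move=> x; have /andP[c0 c1] := chi01 predT x; rewrite ger0_norm.
- move=> x i k; rewrite /chi (bigD1 i)//= [X in _ - X](bigD1 i)//=.
  have -> : \prod_(j | j != i) cut ((k *: delta_mx 0 i + x) ord0 j) = \prod_(j | j != i) cut (x ord0 j).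
    by apply: eq_bigr => j ji; rewrite addrC vertical_coord_neq.
  rewrite -mulrBl (addrC (k *: _)) vertical_coord normrM.
  have /andP[c0 c1] := chi01 (fun j => j != i) x.
  rewrite (le_trans (ler_pM _ _ (cutlip _ _) (_ : _ <= 1)))//; first by rewrite ger0_norm.
  by rewrite mulr1 [_ + k]addrC addrK.
split=> [x Hx|x i Hx].
  rewrite /chi big1// => i _; have := Hx i; rewrite ler_norml => /andP[h1 h2].
  by rewrite /cut /th kN kP !d1 ?mulr1// ler_pdivlMl//; lra.
rewrite /chi (bigD1 i)//= (_ : cut _ = 0) ?mul0r// /cut /th kN kP.
have [xi|xi] := leP 0 (x ord0 i).
  by rewrite (ger0_norm xi) in Hx; rewrite [X in _ * X]d0 ?mulr0// ler_pdivrMl//; lra.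
by rewrite (ltr0_norm xi) in Hx; rewrite d0 ?mul0r// ler_pdivrMl//; lra.
Qed.

End Cutoff.

(** * Collars of the boundary of the cube *)

Section Collar.
Context {R : realType} {m : nat}.

Definition collar (b : R) : set 'rV[R]_m := [set x | exists i, b < `|x ord0 i|].

Lemma open_collar b : open (collar b).
Proof.
have -> : collar b = \bigcup_(i in setT) [set x : 'rV[R]_m | b < `|x ord0 i|].
  by apply/seteqP; split=> x [i]; [exists i|exists i].
apply: bigcup_open => i _.
have c : continuous (fun x : 'rV[R]_m => `|x ord0 i|).
  move=> x; apply: (@continuous_comp _ _ _ (fun x : 'rV[R]_m => x ord0 i) (fun y : R => `|y|)).
    exact: coord_continuous.
  exact: norm_continuous.
exact: (@open_comp _ _ _ [set y | b < y] (fun x _ => c x) (@open_gt _ b)).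
Qed.

(** The part of the cube outside [U] is compact with sup norms below [1]; half of the gap left by
    the largest one is a uniform thickness. *)
Lemma cube_boundary_collar (U : set 'rV[R]_m) : open U -> @cube_boundary R m `<=` U ->
  exists2 kap : R, 0 < kap < 1 & forall (x : 'rV[R]_m) i, cube x -> 1 - kap <= `|x ord0 i| -> U x.
Proof.
move=> oU bU; pose K := @cube R m `&` ~` U.
have cK : compact K.
  have clK : closed K.
    apply: closedI; last exact: open_closedC.
    by apply: compact_closed; [exact: norm_hausdorff|exact: cube_compact].
  by apply: (subclosed_compact clK (@cube_compact R m)) => x [].
have [[x0 Kx0]|K0] := pselect (K !=set0); last first.
  exists (1/2); first by apply/andP; split; lra.
  move=> x i cx _; apply: contrapT => nU; apply: K0; by exists x.
have [|||c cinK Hc] := @EVT_max_rV R m (fun x => `|x|) K.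
- by exists x0.
- exact: cK.
- by apply: continuous_subspaceT => x; exact: norm_continuous.
have [cc nUc] : K c by move: cinK; rewrite inE.
have c1 : `|c| < 1.
  rewrite [ltLHS]/Num.Def.normr/= mx_normrE; apply/bigmax_ltP; split=> // -[i j] _ /=.
  rewrite (ord1 i) lt_neqAle cc andbT; apply/eqP => cj.
  by apply: nUc; apply: bU; split=> //; exists j.
have c0 : 0 <= `|c| by [].
exists ((1 - `|c|) / 2); first by apply/andP; split; lra.
move=> x i cx xi; apply: contrapT => nU.
have xK : x \in K by rewrite inE.
by have := Hc x xK; have := rV_coord_le_norm x i; lra.
Qed.

End Collar.

Lemma mfact_ge1 (R : realType) m (a : 'I_m -> nat) : 1 <= (mfact a)%:R :> R.
Proof. by rewrite ler1n /mfact prodn_gt0// => i; rewrite fact_gt0. Qed.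

(** * The theorem *)

Theorem mainTheorem7 (R : realType) (k m n l r : nat)
  (hkm : (k < m)%N) (hn : (0 < n)%N) (hlr : (l < r)%N)
  (s : jet_section R m n) (hs : smooth_section r s)
  (hbd : exists U : set 'rV[R]_m, open U /\ @cube_boundary R m `<=` U /\
           forall x, U x -> @cube R m x ->
             forall a j, (mdeg a <= r)%N -> s x a j = 0)
  (hl : forall x, @cube R m x -> forall a j, (mdeg a <= l)%N -> s x a j = 0)
  (eps : R) (heps : 0 < eps) :
  exists (F : R * 'rV[R]_m -> 'rV[R]_m) (sh : jet_section R m n),
    isotopy F /\ holonomic_on r (@cube R m) sh /\
    (exists V : set 'rV[R]_m, open V /\
       (fun x => F (1, x)) @` @subcube R m k `<=` V /\
       forall x, V x -> @cube R m x -> forall a j, (mdeg a <= r)%N ->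
         `|sh x a j - s x a j| < eps) /\
    (forall x, @cube R m x -> forall a j, (mdeg a <= l)%N -> `|sh x a j| < eps) /\
    (forall t x, 0 <= t <= 1 -> @cube R m x -> `|F (t, x) - x| < eps) /\
    (exists W : set 'rV[R]_m, open W /\ @cube_boundary R m `<=` W /\
       forall x, W x -> @cube R m x ->
         (forall t, 0 <= t <= 1 -> F (t, x) = x) /\
         (forall a j, (mdeg a <= r)%N -> sh x a j = 0)).
Proof.
have [U [oU [bU sU]]] := hbd.
have [kap /andP[kap0 kap1] Hkap] := cube_boundary_collar oU bU.
(* The first coordinate that vanishes on the subcube; it exists because [k < m]. *)
pose i0 : 'I_m := Ordinal hkm.
have [chi [L [schi L0 chi1 chilip [chiE1 chiE0]]]] := @exists_cutoff R m _ kap0.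
have kap2 : 0 < kap / 2 by rewrite divr_gt0.
(* The isotopy is cut off in a thinner collar than the section: off [O] one has [chiF = 1], as
   [3/8 * kap >= 5/8 * (kap / 2)], so [phi] is used in full wherever [s] has not been shown to
   vanish. *)
have [chiF [LF [schiF LF0 chiF1 chiFlip [chiFE1 chiFE0]]]] := @exists_cutoff R m _ kap2.
pose O := @collar R m (1 - 3/8 * kap).
pose OF := @collar R m (1 - 3/8 * (kap / 2)).
have oO : open O by exact: open_collar.
have OFO : OF `<=` O by move=> x [i xi]; exists i; lra.
(* The corrections must vanish on [O] in the whole space, whereas [s] is known to vanish near the
   boundary only inside the cube: hence the factor [chi]. The factorials turn Taylor coefficients
   into derivatives. *)
pose S (j : 'I_n) (a : 'I_m -> nat) (x : 'rV[R]_m) : R := chi x * ((mfact a)%:R * s x a j).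
have sS j a : (mdeg a <= r)%N -> smooth (S j a).
  by move=> ar; exact: smooth_mul schi (smooth_scale _ (hs a j ar)).
have SO j a x : (mdeg a <= r)%N -> O x -> S j a x = 0.
  by move=> ar [i xi]; rewrite /S (chiE0 x i) ?mul0r// ltW.
have scube (x : 'rV[R]_m) i : cube x -> 1 - kap <= `|x ord0 i| ->
    forall a j, (mdeg a <= r)%N -> s x a j = 0.
  by move=> cx xi a j ar; apply: sU => //; exact: Hkap xi.
have Sl j a p : cube p -> (mdeg a <= l)%N -> S j a p = 0.
  by move=> cp al; rewrite /S hl// !mulr0.
have SE j a p : cube p -> (mdeg a <= r)%N -> S j a p = (mfact a)%:R * s p a j.
  move=> cp ar; have [[i pi]|Hp] := pselect (exists i, 1 - kap <= `|p ord0 i|).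
    by rewrite /S (scube p i)// !mulr0.
  rewrite /S chiE1 ?mul1r// => i; rewrite leNgt; apply/negP => pi; apply: Hp; exists i; lra.
(* The first bound serves the estimates of the statement; the second makes [chiF * phi]
   half-Lipschitz along verticals, [LF] being known before [phi]. *)
pose nu := Num.min (eps / 2) (2 * LF)^-1.
have nu0 : 0 < nu by rewrite lt_min divr_gt0//= invr_gt0 mulr_gt0.
have nueps : nu < eps by rewrite gt_min; apply/orP; left; lra.
have nuLF : nu * LF <= 1 / 2.
  rewrite -ler_pdivlMr// (_ : _ / _ = (2 * LF)^-1) ?ge_min ?lexx ?orbT//.
  by rewrite div1r invfM.
have [phi [h [eta [[sphi iphi eta0 phile] [sh hO hlo hhi]]]]] :=
  @holonomic_approximation R m n i0 O S l r nu sS SO Sl (ltnW hlr) oO nu0.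
pose v x := chiF x * phi x.
have sv : smooth v := smooth_mul schiF sphi.
have vle x : `|v x| <= nu.
  by rewrite /v normrM (le_trans (ler_pM _ _ (chiF1 x) (phile x)))// mul1r.
have vlip x (c : R) : `|v (c *: delta_mx 0 i0 + x) - v x| <= `|c| / 2.
  have -> : v (c *: delta_mx 0 i0 + x) - v x = (chiF (c *: delta_mx 0 i0 + x) - chiF x) * phi x.
    have pE : phi (c *: delta_mx 0 i0 + x) = phi x by rewrite addrC iphi.
    by rewrite /v pE mulrBl.
  rewrite normrM (le_trans (ler_pM _ _ (chiFlip x i0 c) (phile x)))//.
  rewrite (_ : LF * `|c| * nu = `|c| * (nu * LF)); last by ring.
  by rewrite ler_wpM2l// (le_trans nuLF)// div1r.
have v0 (x : 'rV[R]_m) i : 1 - 3/8 * (kap / 2) <= `|x ord0 i| -> v x = 0.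
  by move=> xi; rewrite /v (chiFE0 x i)// mul0r.
pose F (tx : R * 'rV[R]_m) := tx.2 + (tx.1 * v tx.2) *: delta_mx 0 i0.
pose H (y : 'rV[R]_m) : 'rV[R]_n := \row_j h j y.
pose sg : jet_section R m n := fun x a j => pder a (h j) x / (mfact a)%:R.
have HE j : (fun y => H y ord0 j) = h j by apply/funext => y; rewrite mxE.
have hOd j a x : O x -> pder a (h j) x = 0.
  move=> Ox; rewrite pderE.
  have nO : \forall y \near x, h j y = 0.
    by have := open_nbhs_nbhs (conj oO Ox); apply: filterS => y; exact: hO.
  by rewrite (near_pd _ nO); case: (seq_of_exponents a) => [|i js]; rewrite ?pd_cst.
have mf0 (a : 'I_m -> nat) : 0 < (mfact a)%:R :> R by exact: lt_le_trans ltr01 (mfact_ge1 R a).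
have divm (X : R) (a : 'I_m -> nat) : `|X| <= nu -> `|X / (mfact a)%:R| < eps.
  move=> Xnu; rewrite normrM normfV (gtr0_norm (mf0 a)) (le_lt_trans _ nueps)//.
  by rewrite ler_pdivrMr// (le_trans Xnu)// ler_peMr ?mfact_ge1// ltW.
exists F, sg; split; [|split; [|split; [|split; [|split]]]].
- apply: vertical_isotopy => // x xi; apply: (v0 x i0); lra.
- exists H; split.
    by apply: smooth_mx => j; rewrite HE; exact: sh.
  by move=> x cx a j ar; rewrite /sg HE.
(* In [O] the pushed subcube may miss the graph, but there [sg] vanishes, and so does [s] within the
   cube. A point of the subcube in [O] stays in [O]: its large coordinate is not [i0], where it is
   [0], so it is unchanged. *)
- exists ([set x : 'rV[R]_m | `|x ord0 i0 - phi x| < eta] `|` O); split; [|split].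
  + apply: openU; last exact: open_collar.
    have c : continuous (fun x : 'rV[R]_m => `|x ord0 i0 - phi x|).
      have sc : smooth (fun x : 'rV[R]_m => x ord0 i0 - phi x) := smooth_sub (smooth_coord i0) sphi.
      have cc : continuous (fun x : 'rV[R]_m => x ord0 i0 - phi x) := smooth_continuous sc.
      move=> x; apply: (@continuous_comp _ _ _ (fun x : 'rV[R]_m => x ord0 i0 - phi x) (fun y : R => `|y|)).
        exact: cc.
      exact: norm_continuous.
    exact: (@open_comp _ _ _ [set y | y < eta] (fun x _ => c x) (@open_lt _ eta)).
  + move=> _ [x [cx xk] <-]; have x0 : x ord0 i0 = 0 by apply: xk.
    rewrite /F /= mul1r; have [[i xi]|Ox] := pselect (O x); [right|left].
      exists i; rewrite vertical_coord_neq//; apply/eqP => ii.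
      by move: xi; rewrite ii x0 normr0; lra.
    have chF : chiF x = 1.
      apply: chiFE1 => i; rewrite leNgt; apply/negP => xi; apply: Ox; exists i; lra.
    by rewrite /= vertical_coord x0 add0r iphi /v chF mul1r subrr normr0.
  + move=> x [tube|[i xi]] cx a j ar.
      have := hhi x a j cx tube ar; rewrite SE// => /divm-/(_ a).
      by rewrite mulrBl mulrAC mulfV ?mul1r// gt_eqF.
    rewrite /sg hOd; last by exists i.
    by rewrite mul0r (scube x i) ?subrr ?normr0//; lra.
- by move=> x cx a j al; apply: divm; exact: hlo.
- move=> t x /andP[t0 t1] cx; rewrite /F /= addrC addKr.
  rewrite (le_lt_trans _ nueps)// normrZ normrM (ger0_norm t0).
  have e1 : `|delta_mx 0 i0 : 'rV[R]_m| <= 1.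
    apply: rV_norm_le => // i; rewrite mxE; case: (_ && _); by rewrite ?normr1 ?normr0.
  rewrite -[leRHS]mulr1 ler_pM ?mulr_ge0//.
  by rewrite -[leRHS]mul1r ler_pM.
- exists OF; split; [exact: open_collar|split].
    move=> x [cx [i xi]]; exists i; rewrite xi; lra.
  move=> x OFx cx; split=> [t _|a j ar]; last by rewrite /sg hOd ?mul0r//; exact: OFO.
  by have [i xi] := OFx; rewrite /F /= (v0 x i) ?mulr0 ?scale0r ?addr0// ltW.
Qed.
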